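(* Let $(H,\|\cdot\|_H,\langle\cdot,\cdot\rangle_H)$ be a separable real Hilbert space, let $T\in(0,\infty)$, $\eta,\delta\in\mathbb R$, let $(\Omega,\mathcal F,\mathbb P,(\mathcal F_t)_{t\in[0,T]})$ be a stochastic basis, let $A\colon D(A)\subseteq H\to H$ be a diagonal linear operator with $\mathrm{spectrum}(A)\subseteq(-\infty,\eta)$, and let $(H_q,\|\cdot\|_{H_q},\langle\cdot,\cdot\rangle_{H_q})$, $q\in\mathbb R$, be a family of interpolation spaces associated to $\eta-A$. Let $r,\beta\in[0,\infty)$, $w\in H_{-\beta}\setminus\{0\}$, let $\xi\colon\Omega\to H_\delta$ be $\mathcal F_0/\mathcal B(H_\delta)$-measurable, let $B\colon H\to HS(\mathbb R,H_{-\beta})$ be the continuous function which satisfies for all $v\in H$, $u\in\mathbb R$ that $B(v)u=u\,\|v\|_H\,w$, let $W\colon[0,T]\times\Omega\to\mathbb R$ be a standard $(\mathcal F_t)_{t\in[0,T]}$-Brownian motion, and let $X\colon[0,T]\times\Omega\to H_\delta$ be an $(\mathcal F_t)_{t\in[0,T]}$-predictable stochastic process which fulfills for all $t\in(0,T]$ that $X((0,T]\times\Omega)\subseteq H$, that $$\mathbb E\big[\|e^{tA}\xi\|^2_{H_{-r}}\big]+\int_0^t\mathbb E\big[\|e^{(t-s)A}B(X_s)\|^2_{HS(\mathbb R,H_{-r})}\big]\,ds<\infty,$$ and $\mathbb P$-a.s. that $X_t=e^{tA}\xi+\int_0^te^{(t-s)A}B(X_s)\,dW_s$. Then for all $t\in(0,T]$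 it holds that $\mathbb P(\xi\in H_{-1/2})=1$ and $$2^{-1/2}\,e^{-|\eta|t}\,\big(1-e^{-2[\eta-\sup(\sigma_p(A))]t}\big)^{1/2}\,\|e^{tA}w\|_{H_{-r}}\,\|\xi\|_{L^2(\mathbb P;H_{-1/2})}\le\|X_t\|_{L^2(\mathbb P;H_{-r})}<\infty.$$
   Context: A stochastic basis is a probability space with a normal filtration (right-continuous, with $\mathcal F_0$ containing all $\mathbb P$-null sets). A process is $(\mathcal F_t)$-predictable if it is measurable with respect to the sigma-algebra on $[0,T]\times\Omega$ generated by the sets $(s,t]\times C$ with $s<t$ in $[0,T]$, $C\in\mathcal F_s$, and $\{0\}\times C$ with $C\in\mathcal F_0$. $A$ diagonal means: there are an orthonormal basis $\mathbb B\subseteq H$ of $H$ and a function $\lambda\colon\mathbb B\to\mathbb R$ with $D(A)=\{v\in H\colon\sum_{b\in\mathbb B}|\lambda_b\langle b,v\rangle_H|^2<\infty\}$ and $Av=-\sum_{b\in\mathbb B}\lambda_b\langle b,v\rangle_Hb$ for $v\in D(A)$. $\sigma_p(A)$ is the point spectrum (set of eigenvalues) of $A$. Interpolation spaces associated to $\eta-A$: for $q\ge0$, $H_q=D((\eta-A)^q)$ with $\|v\|_{H_q}=\|(\eta-A)^qv\|_H$; for $q<0$, $H_q$ is the completion of $H$ with respect to $\|v\|_{H_q}=\|(\eta-A)^qv\|_H$; the semigroup operators $e^{tA}$ are extended to the spaces $H_q$ in the usual way. The spaces are nested ($H_q\subseteq H_{q'}$ for $q\ge q'$). $HS(V,W)$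 is the space of Hilbert–Schmidt operators from $V$ to $W$. $\|Z\|_{L^2(\mathbb P;V)}=(\mathbb E\|Z\|_V^2)^{1/2}$. *)

(* Defs.v *)
From HB Require Import structures.
From mathcomp Require Import all_boot all_order all_algebra.
From mathcomp Require Import sesquilinear.
From mathcomp Require Import all_classical all_reals all_analysis.
Import numFieldNormedType.Exports.
Import Order.TTheory GRing.Theory Num.Theory.

Set Implicit Arguments.
Unset Strict Implicit.
Unset Printing Implicit Defensive.

Local Open Scope classical_set_scope.
Local Open Scope ring_scope.

(* A real Hilbert space is a complete normed space whose norm comes from a
   symmetric positive definite bilinear form. *)
Definition hilbert_dot (R : realType) (H : completeNormedModType R)
    (ip : {dot H for idfun}) : Prop :=
  forall v : H, ip v v = `|v| ^+ 2.

Definition separable (V : topologicalType) : Prop :=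
  exists D : set V, countable D /\ dense D.

(* The filter of finite subsets of BB directed by inclusion: limits along it
   are unordered sums over BB. *)
Definition finite_subsets (T : Type) (BB : set T) : set_system (set T) :=
  filter_from [set F : set T | finite_set F /\ F `<=` BB]
    (fun F => [set G : set T | [/\ finite_set G, F `<=` G & G `<=` BB]]).

Section Diagonal.
Context {R : realType} {H : completeNormedModType R}.
Variable ip : {dot H for idfun}.

Definition orthonormal_basis (BB : set H) : Prop :=
  [/\ forall b, BB b -> ip b b = 1,
      forall b c, BB b -> BB c -> b != c -> ip b c = 0
    & forall v : H,
        (\sum_(b \in G) ip b v *: b) @[G --> finite_subsets BB] --> v].

(* The operator with eigenvalue [mu b] at the basis vector [b], and its
   natural domain; values of [mu] off [BB] are irrelevant.  With [mu] equal
   to [phi] applied to the eigenvalues of a diagonal operator A, this is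
   phi(A). *)
Definition diag_dom (BB : set H) (mu : H -> R) : set H :=
  [set v | (\esum_(b in BB) (`|mu b * ip b v| ^+ 2)%:E < +oo)%E].

Definition diag_op (BB : set H) (mu : H -> R) (v : H) : H :=
  lim ((\sum_(b \in G) (mu b * ip b v) *: b) @[G --> finite_subsets BB]).

(* Note the sign convention: the eigenvalues of A are the numbers
   [- lam b]. *)
Definition diagonal_operator (BB : set H) (lam : H -> R)
    (DA : set H) (A : H -> H) : Prop :=
  [/\ orthonormal_basis BB,
      DA = diag_dom BB lam
    & forall v, DA v -> A v = - diag_op BB lam v].

(* eta - A has eigenvalues [eta + lam b]. *)
Definition frac_dom (BB : set H) (lam : H -> R) (eta q : R) : set H :=
  diag_dom BB (fun b => (eta + lam b) `^ q).

Definition frac_pow (BB : set H) (lam : H -> R) (eta q : R) : H -> H :=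
  diag_op BB (fun b => (eta + lam b) `^ q).

Definition exp_semigroup (BB : set H) (lam : H -> R) (t : R) : H -> H :=
  diag_op BB (fun b => expR (t * - lam b)).

End Diagonal.

Section Spectrum.
Context {R : realType} {H : completeNormedModType R}.
Variables (DA : set H) (A : H -> H).

Definition resolvent_set : set R :=
  [set mu | exists Rmu : H -> H,
    [/\ continuous Rmu,
        forall y, DA (Rmu y) /\ mu *: Rmu y - A (Rmu y) = y
      & forall v, DA v -> Rmu (mu *: v - A v) = v]].

Definition spectrum : set R := ~` resolvent_set.

Definition point_spectrum : set R :=
  [set mu | exists v, [/\ DA v, v != 0 & A v = mu *: v]].

End Spectrum.

(* The nested scale (H_q) is presented as Hilbert spaces [isp q], all
   injected into one vector space [ambient] in which the identification
   "H_q is a subset of H_q'" takes place; H itself is injected by [inclH].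
   For q < 0, a completion of H is a complete space in which H embeds densely
   and isometrically; continuity of the inclusions makes the completions
   for different q compatible. *)
Record interpolation_spaces (R : realType) (H : completeNormedModType R)
    (ip : {dot H for idfun}) (BB : set H) (lam : H -> R) (eta : R) := {
  ambient : lmodType R ;
  isp : R -> completeNormedModType R ;
  isp_dot : forall q, {dot (isp q) for idfun} ;
  inclH : {linear H -> ambient} ;
  inclq : forall q, {linear (isp q) -> ambient} ;
  isp_hilbert : forall q, hilbert_dot (isp_dot q) ;
  inclH_inj : injective inclH ;
  inclq_inj : forall q, injective (inclq q) ;
  isp_pos : forall q : R, 0 <= q ->
    range (inclq q) = inclH @` frac_dom ip BB lam eta q ;
  isp_neg : forall q : R, q < 0 ->
    range inclH `<=` range (inclq q) /\
    dense [set y : isp q | exists v, inclq q y = inclH v] ;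
  isp_norm : forall q (y : isp q) (v : H), inclq q y = inclH v ->
    `|y| = `|frac_pow ip BB lam eta q v| ;
  isp_nested : forall q q' : R, q' <= q ->
    exists f : isp q -> isp q',
      continuous f /\ forall y, inclq q' (f y) = inclq q y }.

Section Spaces.
Context {R : realType} {H : completeNormedModType R} {ip : {dot H for idfun}}
  {BB : set H} {lam : H -> R} {eta : R}.
Variable K : interpolation_spaces ip BB lam eta.

(* The H_q-norm on the ambient space, with value +oo outside H_q. *)
Definition qnorm (q : R) (x : ambient K) : \bar R :=
  ereal_inf [set (`|y|)%:E | y in [set y : isp K q | inclq K q y = x]].

(* x as an element of H (0 if x is not in H). *)
Definition toH (x : ambient K) : H := xget 0 [set v | inclH K v = x].

(* e^{tA} on H together with its extensions to the H_q. *)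
Definition extended_semigroup (S : R -> ambient K -> ambient K) : Prop :=
  forall t, 0 <= t ->
    (forall v, S t (inclH K v) = inclH K (exp_semigroup ip BB lam t v)) /\
    (forall q, exists f : {linear (isp K q) -> (isp K q)},
       continuous f /\ forall y, inclq K q (f y) = S t (inclq K q y)).

(* Squared Hilbert-Schmidt norm of L : R -> H_q: the sum of the ||L u||^2
   over the orthonormal basis {1} of the Hilbert space R. *)
Definition HSnorm2 (q : R) (L : R -> ambient K) : \bar R :=
  (\esum_(u in [set 1%R]) (qnorm q (L u)) ^+ 2)%E.

Definition HS (q : R) : set (R -> ambient K) :=
  [set L | (forall a x y, L (a * x + y) = a *: L x + L y) /\
           (HSnorm2 q L < +oo)%E].

Definition HS_open (q : R) : set (set (R -> ambient K)) :=
  [set U | U `<=` HS q /\ forall L, U L -> exists2 e : R, 0 < e &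
     forall L', HS q L' ->
       (HSnorm2 q (fun u => (L' u - L u)%R) < (e ^+ 2)%:E)%E -> U L'].

Definition HS_continuous (q : R) (B : H -> R -> ambient K) : Prop :=
  forall v (e : R), 0 < e -> exists2 del : R, 0 < del &
    forall v', `|v' - v| < del ->
      (HSnorm2 q (fun u => (B v' u - B v u)%R) < (e ^+ 2)%:E)%E.

End Spaces.

Section Stochastic.
Context {R : realType} {d : measure_display} {Omega : measurableType d}.
Variables (P : probability Omega R) (T : R) (F : R -> set (set Omega)).

Record normal_filtration : Prop := {
  filtration_sigma : forall t : R, 0 <= t <= T ->
    sigma_algebra [set: Omega] (F t) /\
    F t `<=` (measurable : set (set Omega)) ;
  filtration_mono : forall s t : R, 0 <= s -> s <= t -> t <= T -> F s `<=` F t ;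
  filtration_right_continuous : forall t : R, 0 <= t < T ->
    F t = \bigcap_(s in `]t, T]) F s ;
  filtration_null : forall N : set Omega,
    measurable N -> P N = 0%E -> F 0 N }.

Definition borel_measurable (G : set (set Omega)) (V : topologicalType)
    (f : Omega -> V) : Prop :=
  forall U : set V, <<s @open V >> U -> G (f @^-1` U).

Definition predictable : set (set (R * Omega)) :=
  <<s `[0, T] `*` [set: Omega],
    [set S | exists s t C, [/\ 0 <= s, s < t, t <= T, F s C
                             & S = `]s, t] `*` C]] `|`
    [set S | exists2 C, F 0 C & S = [set 0] `*` C] >>.

Definition predictable_process (V : topologicalType) (X : R -> Omega -> V) :
    Prop :=
  forall U : set V, <<s @open V >> U ->
    predictable [set p | 0 <= p.1 <= T /\ U (X p.1 p.2)].

Record brownian_motion (W : R -> Omega -> R) : Prop := {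
  bm_adapted : forall t : R, 0 <= t <= T -> borel_measurable (F t) (W t) ;
  bm_start : {ae P, forall w, W 0 w = 0} ;
  bm_continuous :
    {ae P, forall w, {within `[0, T], continuous (fun t => W t w)}} ;
  bm_increment : forall (s t : R) (U : set R), 0 <= s -> s < t -> t <= T ->
    measurable U ->
    P [set w | U (W t w - W s w)] = normal_prob 0 (Num.sqrt (t - s)) U ;
  bm_independent : forall (s t : R) (C : set Omega) (U : set R),
    0 <= s -> s < t -> t <= T -> F s C -> measurable U ->
    P (C `&` [set w | U (W t w - W s w)]) =
    (P C * P [set w | U (W t w - W s w)%R])%E }.

End Stochastic.

Section Ito.
Context {R : realType} {H : completeNormedModType R} {ip : {dot H for idfun}}
  {BB : set H} {lam : H -> R} {eta : R}.
Variable K : interpolation_spaces ip BB lam eta.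
Context {d : measure_display} {Omega : measurableType d}.
Variables (P : probability Omega R) (T : R) (F : R -> set (set Omega)).

(* The HS(R, H_q)-valued elementary process
   sum_i 1_{(a_i, b_i]} 1_{C_i} L_i on [0, t]. *)
Record elementary (q t : R) := {
  el_size : nat ;
  el_a : 'I_el_size -> R ;
  el_b : 'I_el_size -> R ;
  el_C : 'I_el_size -> set Omega ;
  el_L : 'I_el_size -> R -> ambient K ;
  el_time : forall i, 0 <= el_a i /\ el_a i <= el_b i /\ el_b i <= t ;
  el_event : forall i, F (el_a i) (el_C i) ;
  el_HS : forall i, HS q (el_L i) }.

Definition el_process q t (phi : elementary q t) (s : R) (w : Omega) (u : R) :
    ambient K :=
  \sum_(i < el_size phi)
    ((\1_(`]el_a i, el_b i]) s : R) * \1_(el_C i) w) *: el_L i u.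

Definition el_integral (W : R -> Omega -> R) q t (phi : elementary q t)
    (w : Omega) : ambient K :=
  \sum_(i < el_size phi)
    (\1_(el_C i) w : R) *: el_L i (W (el_b i) w - W (el_a i) w).

(* [I] is a version of int_0^t Phi_s dW_s for the predictable
   HS(R, H_q)-valued integrand Phi: the L^2-limit of the integrals of
   elementary processes converging to Phi in L^2((0,t) x Omega; HS(R, H_q)). *)
Definition ito_integral (W : R -> Omega -> R) (q t : R)
    (Phi : R -> Omega -> R -> ambient K) (I : Omega -> isp K q) : Prop :=
  [/\ forall s w, 0 < s < t -> HS q (Phi s w),
      forall U, <<s HS q, HS_open q >> U ->
        predictable T F [set p | 0 < p.1 < t /\ U (Phi p.1 p.2)],
      borel_measurable measurable I
    & exists phi : nat -> elementary q t,
        ((\int[lebesgue_measure]_(s in `]0%R, t[) \int[P]_w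
            HSnorm2 q (fun u => (el_process (phi n) s w u - Phi s w u)%R))%E
           @[n --> \oo] --> 0%E) /\
        ((\int[P]_w
            (qnorm q (el_integral W (phi n) w - inclq K q (I w))%R ^+ 2))%E
           @[n --> \oo] --> 0%E)].

End Ito.

(* Main.v *)
Require Import Defs.
From HB Require Import structures.
From mathcomp Require Import all_boot all_order all_algebra.
From mathcomp Require Import sesquilinear.
From mathcomp Require Import all_classical all_reals all_analysis.
From mathcomp Require Import measurable_realfun ring lra.
Import numFieldNormedType.Exports.
Import Order.TTheory GRing.Theory Num.Theory.
Import HBNNSimple.

Set Implicit Arguments.
Unset Strict Implicit.
Unset Printing Implicit Defensive.

Local Open Scope classical_set_scope.
Local Open Scope ring_scope.

(* Everything is read off in coordinates.  Let m_b = eta + lam_b be the eigenvalues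
   of eta - A, bounded below by kappa = eta - sup(sigma_p(A)) > 0, and write x_b for
   the coordinate of x at the basis vector b.  The noise is orthogonal to the
   F_0-measurable initial value, so by Ito's isometry
     E|(X_t)_b|^2 >= e^(-2 lam_b t) E|xi_b|^2
       + |w_b|^2 int_0^t e^(-2 lam_b (t - s)) E||X_s||^2 ds.
   The first term, summed over all c, bounds E||X_s||^2 from below by
   sum_c e^(-2 lam_c s) E|xi_c|^2.  Inserting this in the second term and using
   lam_b >= - eta gives, after weighting with m_b^(-2r) and summing over b,
     E||X_t||_(-r)^2 >= ||e^(tA) w||_(-r)^2
       sum_c E|xi_c|^2 (1 - e^(-2 m_c t)) / (2 m_c),
   where the sum is at least (1 - e^(-2 kappa t)) / 2 times E||xi||_(-1/2)^2.  Since
   the left-hand side is finite and w <> 0, so is E||xi||_(-1/2)^2.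

   Only the inequality in Ito's isometry is needed, and it passes to the limit from
   elementary integrands by Young's inequality, without any measurability of the
   integrand in the product space. *)

(** * Sums over arbitrary index sets *)

(** Measurability of E||X_s||^2 in s is never established. Every estimate is therefore one-sided:
    the integral of a nonnegative function is monotone as a supremum over simple functions, and
    splitting a sum is allowed as soon as one summand is measurable, a role that step processes,
    coordinates and explicit majorants can play. Elements of different H_q meet only in the ambient
    space, so a coordinate must not depend on q: it is fixed by its value on H and carried to H_q by
    density. Lying in H_q then means that a weighted square sum is finite. Pythagoras in coordinate
    b needs E|xi_b|^2 to be finite beforehand; this is extracted for each b separately, with a
    constant depending on b. Summability over b is a conclusion, so the sums are kept in the
    extended reals until the end. The index -1/2 has this origin: bounding e^(2 lam_b s) below by
    e^(-2 eta s) decouples b from c and turns the exponent lam_c into m_c, whose time integral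
    produces 1 / (2 m_c). *)

Section Esum.
Context {R : realType} {J : choiceType}.
Implicit Types (D : set J) (f : J -> \bar R).
Local Open Scope ereal_scope.

Lemma esum_term D f j : (forall i, D i -> 0 <= f i) -> D j -> f j <= \esum_(i in D) f i.
Proof.
move=> f0 Dj; apply: esum_ge; exists [set j].
  by split; [exact: finite_set1|move=> ? ->].
by rewrite fsbig_set1.
Qed.

(** For finite c, the inequality [step] is used with c and with its inverse. The case c = +oo is
    included because [weighted_moment] appears as a factor before it is known to be finite; there,
    either all terms vanish or one positive term makes both sides infinite. *)
Lemma esumZl D (c : \bar R) f : 0 <= c -> (forall i, D i -> 0 <= f i) ->
  \esum_(i in D) (c * f i) = c * \esum_(i in D) f i.
Proof.
move=> c0 f0.
have step (x : R) (g : J -> \bar R) : (0 <= x)%R -> (forall i, D i -> 0 <= g i) ->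
    \esum_(i in D) (x%:E * g i) <= x%:E * \esum_(i in D) g i.
  move=> x0 g0; apply: ge_ereal_sup => _ [G [finG GD] <-].
  rewrite fsbig_finite//= big_seq -ge0_sume_distrr -?big_seq; last first.
    by move=> i; rewrite in_fset_set// inE => /GD/g0.
  rewrite lee_wpmul2l//; apply: esum_ge; exists G => //.
  by rewrite fsbig_finite.
case: c c0 => [c| |//] c0; last first.
  have [z|/existsNP[j /not_implyP[Dj /eqP fj]]] := pselect (forall i, D i -> f i = 0).
    by rewrite !esum1// ?mule0// => i Di; rewrite z// mule0.
  have fj0 : 0 < f j by rewrite lt0e fj f0.
  rewrite gt0_mulye; last by rewrite (lt_le_trans fj0)// esum_term.
  apply/eqP; rewrite eq_le leey/= -[X in X <= _](gt0_mulye fj0).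
  by apply: (@esum_term D (fun i => +oo * f i) j) => // i Di; rewrite mule_ge0 ?f0.
have [->|cn0] := eqVneq c 0%R.
  by rewrite mul0e esum1// => i _; rewrite mul0e.
have cgt0 : (0 < c)%R by rewrite lt0r cn0.
apply/eqP; rewrite eq_le step//=.
rewrite -lee_pdivlMl//.
have <- : \esum_(i in D) (c^-1%:E * (c%:E * f i)) = \esum_(i in D) f i.
  by apply: eq_esum => i _; rewrite muleA -EFinM mulVf// mul1e.
by apply: step => [|i Di]; [rewrite invr_ge0 ltW|rewrite mule_ge0// f0].
Qed.

Lemma esumD1 D f j : (forall i, D i -> 0 <= f i) -> D j ->
  \esum_(i in D) f i = f j + \esum_(i in D `\ j) f i.
Proof.
move=> f0 Dj; rewrite (esumID [set j])//; congr (_ + _).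
rewrite (_ : D `&` [set j] = [set j]) ?esum_set1//; first exact: f0.
by apply/seteqP; split=> [i []//|i ->].
Qed.

Lemma esum_single D f j : (forall i, D i -> 0 <= f i) -> D j ->
  (forall i, D i -> i != j -> f i = 0) -> \esum_(i in D) f i = f j.
Proof.
move=> f0 Dj fj; rewrite (esumD1 f0 Dj) esum1 ?adde0// => i [Di /eqP ij].
exact: fj.
Qed.

End Esum.

(** * Orthonormal families and diagonal operators *)

Section HilbertSpace.
Context {R : realType} {V : completeNormedModType R} {ip : {dot V for idfun}}.
Hypothesis hip : hilbert_dot ip.

Lemma dotC u v : ip u v = ip v u.
Proof. by rewrite hermC expr0 mul1r. Qed.

Lemma dotDr u v w : ip u (v + w) = ip u v + ip u w.
Proof. exact: linearDr. Qed.

Lemma dotBr u v w : ip u (v - w) = ip u v - ip u w.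
Proof. exact: linearBr. Qed.

Lemma dotZr a u v : ip u (a *: v) = a * ip u v.
Proof. by rewrite linearZr_LR. Qed.

Lemma dotZl a u v : ip (a *: u) v = a * ip u v.
Proof. by rewrite dotC dotZr dotC. Qed.

Lemma dot0r u : ip u 0 = 0.
Proof. exact: linear0r. Qed.

Lemma normB_sqr u v : `|u - v| ^+ 2 = `|u| ^+ 2 - 2 * ip u v + `|v| ^+ 2.
Proof.
rewrite -!hip dotBr [ip _ u]dotC [ip _ v]dotC !dotBr [ip v u]dotC; ring.
Qed.

Lemma normD_sqr u v : `|u + v| ^+ 2 = `|u| ^+ 2 + 2 * ip u v + `|v| ^+ 2.
Proof.
rewrite -!hip dotDr [ip _ u]dotC [ip _ v]dotC !dotDr [ip v u]dotC; ring.
Qed.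

Lemma dot_cauchy_schwarz u v : `|ip u v| <= `|u| * `|v|.
Proof.
have [->|v0] := eqVneq v 0; first by rewrite dot0r normr0 mulr_ge0.
have nv : 0 < `|v| by rewrite normr_gt0.
have := sqr_ge0 `|u - (ip u v / `|v| ^+ 2) *: v|.
rewrite normB_sqr dotZr normrZ exprMn real_normK ?num_real//.
move=> h; rewrite -ler_sqr ?nnegrE ?mulr_ge0// real_normK ?num_real// exprMn.
suff -> : `|u| ^+ 2 * `|v| ^+ 2 = ip u v ^+ 2 + (`|u| ^+ 2 -
  2 * (ip u v / `|v| ^+ 2 * ip u v) +
  (ip u v / `|v| ^+ 2) ^+ 2 * `|v| ^+ 2) * `|v| ^+ 2.
  by rewrite lerDl mulr_ge0 ?sqr_ge0.
by field; rewrite gt_eqF.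
Qed.

Lemma dot_continuous u : continuous (ip u).
Proof.
move=> v; apply/cvgrPdist_lt => e e0; near=> w.
rewrite -dotBr (le_lt_trans (dot_cauchy_schwarz _ _))//.
have : `|v - w| < e / (`|u| + 1).
  near: w; apply: cvgr_dist_lt; first exact: cvg_id.
  by rewrite divr_gt0// ltr_wpDl.
have u1 : 0 < `|u| + 1 by rewrite ltr_wpDl.
rewrite ltr_pdivlMr// => /(le_lt_trans _); apply.
by rewrite mulrC ler_wpM2l// lerDl.
Unshelve. all: by end_near. Qed.

Lemma dot_cvg (T : Type) (F : set_system T) (FF : Filter F) (f : T -> V) (l u : V) :
  f x @[x --> F] --> l -> ip u (f x) @[x --> F] --> ip u l.
Proof. by move=> fl; apply: continuous_cvg fl; exact: dot_continuous. Qed.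

End HilbertSpace.

Section FiniteSubsets.
Context {J : choiceType}.
Implicit Types D F G : set J.

Lemma finite_subsets_filter D : ProperFilter (finite_subsets D).
Proof.
apply: filter_from_proper => [|F [finF FD]]; last by exists F; split.
apply: filter_from_filter; first by exists set0; split; [exact: finite_set0|].
move=> F G [finF FD] [finG GD]; exists (F `|` G).
  by split; [rewrite finite_setU|rewrite subUset].
by move=> L [finL FGL LD]; split; split=> // x Fx; apply: FGL; [left|right].
Qed.

End FiniteSubsets.
#[local] Existing Instance finite_subsets_filter.

Section OrthonormalFamily.
Context {R : realType} {V : completeNormedModType R} {ip : {dot V for idfun}}.
Hypothesis hip : hilbert_dot ip.
Context {J : choiceType} {D : set J} {e : J -> V}.
Hypothesis ortho : forall i j, D i -> D j -> ip (e i) (e j) = (i == j)%:R.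

Lemma dot_fsum (G : set J) (a : J -> R) u : finite_set G ->
  ip u (\sum_(j \in G) a j *: e j) = \sum_(j \in G) a j * ip u (e j).
Proof.
move=> finG; rewrite !fsbig_finite//= linear_sumr.
by apply: eq_bigr => j _; rewrite linearZr_LR.
Qed.

Lemma dot_partial_sum (G : set J) (a : J -> R) i : finite_set G -> G `<=` D -> G i ->
  ip (e i) (\sum_(j \in G) a j *: e j) = a i.
Proof.
move=> finG GD Gi; rewrite dot_fsum// (fsbigD1 i)//= ortho ?eqxx ?mulr1; last 2 first.
- exact: GD.
- exact: GD.
rewrite fsbig1 ?addr0// => j [Gj /eqP/=]; rewrite eq_sym => ji.
by rewrite ortho ?(negbTE ji) ?mulr0//; exact: GD.
Qed.

Lemma partial_sum_norm (G : set J) (a : J -> R) : finite_set G -> G `<=` D ->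
  `|\sum_(j \in G) a j *: e j| ^+ 2 = \sum_(j \in G) a j ^+ 2.
Proof.
move=> finG GD; rewrite -hip dot_fsum//; apply: eq_fsbigr => j /[!inE] Gj.
by rewrite dotC dot_partial_sum// expr2.
Qed.

Lemma bessel_eq (G : set J) v : finite_set G -> G `<=` D ->
  `|v - \sum_(j \in G) ip (e j) v *: e j| ^+ 2
  = `|v| ^+ 2 - \sum_(j \in G) ip (e j) v ^+ 2.
Proof.
move=> finG GD; rewrite (normB_sqr hip) partial_sum_norm// dot_fsum//.
rewrite (_ : \sum_(j \in G) ip (e j) v * ip v (e j) = \sum_(j \in G) ip (e j) v ^+ 2).
  by ring.
by apply: eq_fsbigr => j _; rewrite [ip v _]dotC expr2.
Qed.

Lemma bessel v : (\esum_(j in D) (ip (e j) v ^+ 2)%:E <= (`|v| ^+ 2)%:E)%E.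
Proof.
apply: ge_ereal_sup => _ [G [finG GD] <-]; rewrite fsumEFin// lee_fin.
by rewrite -subr_ge0 -bessel_eq// sqr_ge0.
Qed.

Lemma parseval_cvg v :
  (\sum_(j \in G) ip (e j) v *: e j) @[G --> finite_subsets D] --> v ->
  \esum_(j in D) (ip (e j) v ^+ 2)%:E = (`|v| ^+ 2)%:E.
Proof.
move=> vl; apply/eqP; rewrite eq_le bessel/=; apply/lee_addgt0Pr => eps eps0.
have /cvgrPdist_lt/(_ (Num.sqrt eps)) := vl.
rewrite sqrtr_gt0 => /(_ eps0) [F [finF FD] /(_ F) /= vF].
move: vF => /(_ (And3 finF (@subset_refl _ F) FD)).
rewrite -(ltr_pXn2r (n := 2)) ?nnegrE ?normr_ge0 ?sqrtr_ge0// sqr_sqrtr ?(ltW eps0)// => vF.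
have {}vF : `|v - \sum_(j \in F) ip (e j) v *: e j| ^+ 2 < eps by exact: vF.
rewrite (bessel_eq _ finF FD) in vF.
apply: (@le_trans _ _ ((\sum_(j \in F) ip (e j) v ^+ 2)%:E + eps%:E)%E).
  by rewrite -EFinD lee_fin; lra.
rewrite leeD2r// -fsumEFin//; apply: ereal_sup_ubound; exists F => //.
Qed.

(** If the finite set F comes within eps^2 of the supremum, then enlarging F changes the partial sum
    by a vector of squared norm below eps^2; completeness gives the limit. The family need not be
    total, which allows its use in each H_q before totality is known. *)
Lemma riesz_fischer (a : J -> R) : (\esum_(j in D) (a j ^+ 2)%:E < +oo)%E ->
  exists u, [/\ (\sum_(j \in G) a j *: e j) @[G --> finite_subsets D] --> u,
    forall j, D j -> ip (e j) u = a j &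
    \esum_(j in D) (a j ^+ 2)%:E = (`|u| ^+ 2)%:E].
Proof.
set s := esum _ _ => soo.
have s0 : (0 <= s)%E by apply: esum_ge0 => j _; rewrite lee_fin sqr_ge0.
have sfin : s \is a fin_num by rewrite ge0_fin_numE.
have : cvg ((\sum_(j \in G) a j *: e j) @[G --> finite_subsets D]).
  apply/cauchy_cvgP; apply: cauchy_exP => eps eps0.
  have [_ [F [finF FD] <-] Fs] : exists2 x, [set \sum_(x \in A) (a x ^+ 2)%:E | A in fsets D] x &
      (s - (eps ^+ 2)%:E < x)%E.
    by apply: ub_ereal_sup_adherent => //; rewrite exprn_gt0.
  exists (\sum_(j \in F) a j *: e j), F => // G [finG FG GD].
  rewrite -ball_normE/= distrC (fsbigID F)//= setIidr//.
  rewrite addrAC subrr add0r -(ltr_pXn2r (n := 2)) ?nnegrE ?normr_ge0 ?ltW//.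
  have finGF : finite_set (G `&` ~` F) by apply: sub_finite_set finG => x [].
  have GFD : G `&` ~` F `<=` D by move=> x [/GD].
  rewrite partial_sum_norm//.
  have : (\sum_(j \in G) (a j ^+ 2)%:E <= s)%E by apply: ereal_sup_ubound; exists G.
  rewrite (fsbigID F)//= setIidr// !fsumEFin// -(fineK sfin) -EFinD lee_fin => Gs.
  by move: Fs; rewrite fsumEFin// -(fineK sfin) -EFinB lte_fin; lra.
move=> /cvg_ex [u ul]; exists u.
have au j : D j -> ip (e j) u = a j.
  move=> Dj; have h1 := dot_cvg hip (finite_subsets_filter D) (u := e j) ul.
  suff h2 : ip (e j) (\sum_(j0 \in G) a j0 *: e j0) @[G --> finite_subsets D] --> a j.
    exact: (cvg_unique (@norm_hausdorff R _) h1 h2).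
  (* Coordinate j of a partial sum is constant as soon as the index set contains j. *)
  apply: cvg_near_cst; exists [set j]; first by split; [exact: finite_set1|move=> ? ->].
  by move=> G [finG jG GD]; rewrite dot_partial_sum//; exact: jG.
split => //; have <- : \esum_(j in D) (ip (e j) u ^+ 2)%:E = s.
  by apply: eq_esum => j Dj; rewrite au.
apply: parseval_cvg; apply: cvg_trans ul; apply: near_eq_cvg.
exists set0 => [|G [finG _ GD] /=]; first by split; [exact: finite_set0|].
by apply: eq_fsbigr => j /[!inE] /GD Dj; rewrite au.
Qed.

(** The vector that Riesz-Fischer builds from the coordinates of v differs from v by a vector
    orthogonal to the family, hence by 0. *)
Lemma parseval_total v : (forall u, (forall j, D j -> ip (e j) u = 0) -> u = 0) ->
  \esum_(j in D) (ip (e j) v ^+ 2)%:E = (`|v| ^+ 2)%:E.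
Proof.
move=> total.
have [|u [_ uv us]] := @riesz_fischer (fun j => ip (e j) v).
  by rewrite (le_lt_trans (bessel _)) ?ltry.
suff /eqP : v - u = 0 by rewrite subr_eq0 us => /eqP ->.
by apply: total => j Dj; rewrite dotBr uv// subrr.
Qed.

(** Distinct members are at distance sqrt 2, so points of a dense set chosen within 1/2 of them are
    distinct. Countability is what later permits exchanging sums over the basis with integrals. *)
Lemma countable_orthonormal : separable V -> countable D.
Proof.
move=> [S [/countable_injP[g ginj] Sdense]].
have /choice[d dP] : forall j, exists d, S d /\ `|e j - d| < 2^-1.
  move=> j; have [|d [jd Sd]] := Sdense (ball (e j) 2^-1) _ (ball_open _ _).
    by exists (e j); exact: ballxx.
  by exists d; split=> //; rewrite -ball_normE in jd.
apply/countable_injP; exists (g \o d) => i j; rewrite !inE/= => Di Dj.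
move=> /ginj; rewrite !inE => /(_ (dP i).1 (dP j).1) dij.
apply: contrapT => /eqP ij.
have : `|e i - e j| < 1.
  rewrite (le_lt_trans (ler_distD (d i) _ _))// {2}dij distrC [X in _ < X]splitr mul1r.
  by apply: ltrD; rewrite distrC; [exact: (dP i).2|exact: (dP j).2].
rewrite -(ltr_pXn2r (n := 2)) ?nnegrE ?normr_ge0//.
rewrite (normB_sqr hip) -!hip !ortho// !eqxx (negbTE ij) expr1n.
by rewrite mulr0 subr0 ltNge lerDl ler01.
Qed.

End OrthonormalFamily.

Section Diagonal.
Context {R : realType} {H : completeNormedModType R} {ip : {dot H for idfun}}.
Hypothesis hip : hilbert_dot ip.
Context {BB : set H}.
Hypothesis onb : orthonormal_basis ip BB.

Lemma basis_ortho b c : BB b -> BB c -> ip b c = (b == c)%:R.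
Proof.
move=> Bb Bc; have [nb ob _] := onb.
by have [<-|bc] := eqVneq b c; [rewrite nb|rewrite ob].
Qed.

Lemma basis_parseval v : \esum_(b in BB) (ip b v ^+ 2)%:E = (`|v| ^+ 2)%:E.
Proof. by apply: (parseval_cvg hip basis_ortho); have [_ _ /(_ v)] := onb. Qed.

Lemma diag_domE (mu : H -> R) v :
  diag_dom ip BB mu v <-> (\esum_(b in BB) ((mu b * ip b v) ^+ 2)%:E < +oo)%E.
Proof.
rewrite /diag_dom/=; suff -> : \esum_(b in BB) (`|mu b * ip b v| ^+ 2)%:E =
  \esum_(b in BB) ((mu b * ip b v) ^+ 2)%:E by [].
by apply: eq_esum => b _; rewrite real_normK ?num_real.
Qed.

Lemma diag_op_coord (mu : H -> R) v : diag_dom ip BB mu v ->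
  (forall b, BB b -> ip b (diag_op ip BB mu v) = mu b * ip b v) /\
  (`|diag_op ip BB mu v| ^+ 2)%:E = \esum_(b in BB) ((mu b * ip b v) ^+ 2)%:E.
Proof.
move=> /diag_domE /(riesz_fischer hip basis_ortho)[u [ul uc un]].
suff -> : diag_op ip BB mu v = u by rewrite un.
by apply: cvg_lim ul; exact: norm_hausdorff.
Qed.

Lemma bounded_diag_dom (mu : H -> R) (M : R) v :
  (forall b, BB b -> `|mu b| <= M) -> diag_dom ip BB mu v.
Proof.
move=> muM; apply/diag_domE.
have [B0|/set0P[b0 Bb0]] := eqVneq BB set0; first by rewrite B0 esum_set0 ltry.
have M0 : 0 <= M by rewrite (le_trans _ (muM _ Bb0)).
apply: (@le_lt_trans _ _ (\esum_(b in BB) ((M ^+ 2)%:E * (ip b v ^+ 2)%:E))%E).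
  apply: le_esum => b Bb; rewrite -EFinM lee_fin exprMn ler_wpM2r ?sqr_ge0//.
  by rewrite -[_ ^+ 2]real_normK ?num_real// lerXn2r ?nnegrE ?muM.
rewrite esumZl ?lee_fin ?sqr_ge0// => [|b Bb]; last by rewrite lee_fin sqr_ge0.
by rewrite basis_parseval -EFinM ltry.
Qed.

End Diagonal.

(** * Eigenvalues of a diagonal operator and the gap below eta *)

Section SpectralGap.
Context {R : realType} {H : completeNormedModType R} {ip : {dot H for idfun}}.
Hypothesis hip : hilbert_dot ip.
Context {BB : set H}.
Hypothesis onb : orthonormal_basis ip BB.

Lemma basis_ext u v : (forall b, BB b -> ip b u = ip b v) -> u = v.
Proof.
move=> uv; apply/eqP; rewrite -subr_eq0 -normr_eq0 -sqrf_eq0.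
apply/eqP/EFin_inj; rewrite -(basis_parseval hip onb) esum1// => b Bb.
by rewrite dotBr uv// subrr expr0n.
Qed.

Context {lam : H -> R} {DA : set H} {A : H -> H} {eta : R}.
Hypothesis diagA : diagonal_operator ip BB lam DA A.

Lemma basis_eigen b (a : R) : BB b -> DA (a *: b) /\ A (a *: b) = - lam b *: (a *: b).
Proof.
move=> Bb; have [_ DAE AE] := diagA.
have D : DA (a *: b).
  rewrite DAE; apply/diag_domE; rewrite (esum_single (j := b)) ?ltry//.
    by move=> c _; rewrite lee_fin sqr_ge0.
  move=> c Bc cb; rewrite dotZr (basis_ortho onb)// (negbTE cb).
  by rewrite !mulr0 expr0n.
split => //; rewrite AE// scaleNr; congr (- _); apply: basis_ext => c Bc.
rewrite DAE in D; rewrite (diag_op_coord hip onb D).1// !dotZr.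
rewrite (basis_ortho onb)//; have [->//|_] := eqVneq c b.
by rewrite !mulr0.
Qed.

(** A nonzero v has a nonzero coordinate at some b, and comparing that coordinate of A v and mu v
    determines mu. *)
Lemma eigen_basis v mu : DA v -> v != 0 -> A v = mu *: v ->
  exists2 b, BB b & mu = - lam b.
Proof.
move=> Dv v0 Av; have [_ DAE AE] := diagA; apply: contrapT => nmu.
move/eqP: v0; apply; apply: basis_ext => b Bb.
rewrite dot0r; apply: contrapT => /eqP bv; apply: nmu; exists b => //.
move: Av; rewrite AE// => /(congr1 (ip b)); rewrite -scaleN1r !dotZr.
rewrite DAE in Dv; rewrite (diag_op_coord hip onb Dv).1//.
by rewrite mulN1r -mulNr => /(mulIf bv).
Qed.

Hypothesis specA : spectrum DA A `<=` [set x | x < eta].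

(* Since eta lies in the resolvent set, the eigenvalues stay away from eta: the
   resolvent maps b to b / (eta + lam b) and is continuous at 0. *)
Lemma spectral_gap : BB !=set0 ->
  0 < eta - sup (point_spectrum DA A) /\
  forall b, BB b -> eta - sup (point_spectrum DA A) <= eta + lam b.
Proof.
move=> [b0 Bb0]; have [_ DAE AE] := diagA.
have A0 : A 0 = 0.
  by have [_] := basis_eigen 0 Bb0; rewrite !scale0r scaler0.
have D0 : DA 0 by have [] := basis_eigen 0 Bb0; rewrite scale0r.
have bn b : BB b -> `|b| = 1.
  move=> Bb; apply/eqP; rewrite -(@eqrXn2 _ 2)// expr1n -hip (basis_ortho onb)//.
  by rewrite eqxx.
have bnz b : BB b -> b != 0 by move=> /bn b1; rewrite -normr_eq0 b1 oner_eq0.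
have psb b : BB b -> point_spectrum DA A (- lam b).
  move=> Bb; exists b; have [] := basis_eigen 1 Bb.
  by rewrite !scale1r; split => //; exact: bnz.
have pse mu : point_spectrum DA A mu -> mu < eta.
  move=> [v [Dv v0 Av]]; apply: specA => -[Rmu [_ _ RA]].
  have := RA 0 D0; have := RA v Dv; rewrite Av subrr A0 scaler0 subr0 => ->.
  by move/eqP: v0.
have [Reta [Rcont _ RA]] : resolvent_set DA A eta.
  by apply: contrapT => /specA/=; rewrite ltxx.
have R0 : Reta 0 = 0 by have := RA 0 D0; rewrite A0 scaler0 subr0.
have /(_ 1 ltr01) : forall e : R, 0 < e -> \forall y \near (0 : H), `|Reta y| < e.
  move=> e e0; have /cvgrPdist_lt/(_ e e0) := Rcont 0; rewrite R0.
  by apply: filterS => y; rewrite sub0r normrN.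
move=> /nbhs_ballP[del /= del0 Rdel].
have gap b : BB b -> del / 2 <= eta + lam b.
  move=> Bb; have m0 : 0 < eta + lam b by have := pse _ (psb _ Bb); lra.
  pose a := del / 2 / (eta + lam b).
  have [Da Aa] := basis_eigen a Bb.
  have := RA _ Da; rewrite Aa -scalerBl opprK scalerA mulrC divfK ?gt_eqF// => Ra.
  have : `|a *: b| < 1.
    rewrite -Ra; apply: Rdel; rewrite -ball_normE/= sub0r normrN normrZ (bn _ Bb).
    by rewrite mulr1 gtr0_norm ?divr_gt0//; lra.
  rewrite normrZ (bn _ Bb) mulr1 gtr0_norm ?divr_gt0// /a.
  by rewrite ltr_pdivrMr// mul1r => /ltW.
have sup_le : sup (point_spectrum DA A) <= eta - del / 2.
  apply: ge_sup; first by exists (- lam b0); exact: psb.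
  by move=> mu [v [Dv v0 /eigen_basis[]// b /gap + ->]]; lra.
split; first by move: sup_le (divr_gt0 del0 (@ltr0Sn R 1)); lra.
move=> b Bb; have : - lam b <= sup (point_spectrum DA A).
  apply: ub_le_sup; last exact: psb.
  by exists eta => mu /pse/ltW.
by lra.
Qed.

End SpectralGap.

(** * Coordinates on the scale of interpolation spaces *)

Section Scale.
Context {R : realType} {H : completeNormedModType R} {ip : {dot H for idfun}}
  {BB : set H} {lam : H -> R} {eta kappa : R}.
Hypothesis hip : hilbert_dot ip.
Hypothesis onb : orthonormal_basis ip BB.
Hypothesis kappa_gt0 : 0 < kappa.
Hypothesis gap : forall b, BB b -> kappa <= eta + lam b.
Variable K : interpolation_spaces ip BB lam eta.

Local Notation m b := (eta + lam b).

Lemma eigen_gt0 b : BB b -> 0 < m b.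
Proof. by move=> /gap; exact: lt_le_trans. Qed.

Lemma frac_dom_neg (q : R) v : q <= 0 -> frac_dom ip BB lam eta q v.
Proof.
move=> q0; apply: (bounded_diag_dom hip onb (M := kappa `^ q)) => b Bb.
have m0 := eigen_gt0 Bb; rewrite ger0_norm ?powR_ge0//.
rewrite -[q]opprK powRN [leRHS]powRN lef_pV2 ?posrE ?powR_gt0//.
by apply: ge0_ler_powR; [rewrite oppr_ge0|rewrite nnegrE ltW|rewrite nnegrE ltW|exact: gap].
Qed.

Lemma eigen_powR_neq0 q b : BB b -> m b `^ q != 0.
Proof. by move=> /eigen_gt0 m0; rewrite gt_eqF// powR_gt0. Qed.

Lemma frac_dom_of_range q y v : inclq K q y = inclH K v -> frac_dom ip BB lam eta q v.
Proof.
move=> yv; have [q0|q0] := leP 0 q; last exact/frac_dom_neg/ltW.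
have : range (inclq K q) (inclq K q y) by exists y.
by rewrite (isp_pos K q0) yv => -[v' Dv' /(inclH_inj (i := K)) <-].
Qed.

Lemma isp_norm_esum q y v : inclq K q y = inclH K v ->
  (`|y| ^+ 2)%:E = \esum_(b in BB) ((m b `^ q * ip b v) ^+ 2)%:E.
Proof.
move=> yv; rewrite (isp_norm yv).
exact: (diag_op_coord hip onb (frac_dom_of_range yv)).2.
Qed.

Definition isp_basis q b : isp K q := xget 0 [set z | inclq K q z = inclH K b].

Lemma isp_basisE q b : BB b -> inclq K q (isp_basis q b) = inclH K b.
Proof.
move=> Bb; suff [z zb] : exists z, inclq K q z = inclH K b.
  by rewrite /isp_basis; case: xgetP => [y -> //|/(_ z)].
have [q0|q0] := leP 0 q; last first.
  have [/(_ (inclH K b)) + _] := isp_neg K q0.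
  by move=> /(_ (ex_intro2 _ _ b I erefl))[z _ zb]; exists z.
suff : range (inclq K q) (inclH K b) by move=> [z _ zb]; exists z.
rewrite (isp_pos K q0); exists b => //; apply/diag_domE.
rewrite (esum_single (j := b)) ?ltry//.
  by move=> c _; rewrite lee_fin sqr_ge0.
by move=> c Bc cb; rewrite (basis_ortho onb)// (negbTE cb) mulr0 expr0n.
Qed.

(** The scale prescribes norms only, so the inner product is recovered by polarization: the squared
    norms of y + z and y - z, with z the image of b, differ only in coordinate b. The common
    remainder [C] cancels once it is known to be finite. *)
Lemma isp_dot_basis q b y v : BB b -> inclq K q y = inclH K v ->
  isp_dot K q (isp_basis q b) y = m b `^ q ^+ 2 * ip b v.
Proof.
move=> Bb yv; have hq := @isp_hilbert _ _ _ _ _ _ K q; set z := isp_basis q b.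
have zb : inclq K q z = inclH K b := isp_basisE q Bb.
pose C := \esum_(c in BB `\ b) ((m c `^ q * ip c v) ^+ 2)%:E.
have C0 : (0 <= C)%E by apply: esum_ge0 => c _; rewrite lee_fin sqr_ge0.
have E (s : R) : (`|y + s *: z| ^+ 2)%:E =
    ((m b `^ q * (ip b v + s)) ^+ 2)%:E + C :> \bar R.
  rewrite (isp_norm_esum (v := v + s *: b)); last by rewrite !linearD !linearZ/= zb yv.
  rewrite (esumD1 (j := b))//; last by move=> c _; rewrite lee_fin sqr_ge0.
  rewrite dotDr dotZr (basis_ortho onb Bb Bb) eqxx mulr1; congr (_ + _)%E.
  apply: eq_esum => c [Bc /eqP cb]; rewrite dotDr dotZr (basis_ortho onb Bc Bb) (negbTE cb).
  by rewrite mulr0 addr0.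
have Cfin : C \is a fin_num.
  rewrite ge0_fin_numE//; apply: (le_lt_trans (y := (`|y + 0 *: z| ^+ 2)%:E)); last exact: ltry.
  by rewrite E leeDr// lee_fin sqr_ge0.
have := E 1; have := E (- 1); rewrite -(fineK Cfin) -!EFinD => -[E1] [E2].
move: E1 E2; rewrite scaleN1r scale1r (normB_sqr hq) (normD_sqr hq) [isp_dot _ _ y _]dotC.
by rewrite -/z; lra.
Qed.

(** The rescaling is forced by the fact that b has norm m_b^q in H_q. *)
Definition isp_onb q b : isp K q := m b `^ (- q) *: isp_basis q b.

Lemma isp_dot_onb q b y v : BB b -> inclq K q y = inclH K v ->
  isp_dot K q (isp_onb q b) y = m b `^ q * ip b v.
Proof.
move=> Bb yv; rewrite dotZl (isp_dot_basis Bb yv) powRN expr2 -!mulrA.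
by rewrite mulKf// eigen_powR_neq0.
Qed.

Lemma isp_onb_ortho q b c : BB b -> BB c ->
  isp_dot K q (isp_onb q b) (isp_onb q c) = (b == c)%:R.
Proof.
move=> Bb Bc; rewrite dotZr (isp_dot_onb Bb (isp_basisE q Bc)) (basis_ortho onb)//.
have [->|_] := eqVneq b c; last by rewrite !mulr0.
by rewrite mulr1 powRN mulVf// eigen_powR_neq0.
Qed.

Lemma isp_dense q (y : isp K q) (e : R) : 0 < e ->
  exists y' v, inclq K q y' = inclH K v /\ `|y - y'| < e.
Proof.
move=> e0; have [q0|q0] := leP 0 q.
  have : range (inclq K q) (inclq K q y) by exists y.
  rewrite (isp_pos K q0) => -[v _ vy]; exists y, v.
  by rewrite subrr normr0.
have [_ dn] := isp_neg K q0.
have [|y' [/= yy' [v yv]]] := dn (ball y e) _ (ball_open _ _).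
  by exists y; exact: ballxx.
by exists y', v; split=> //; rewrite -ball_normE in yy'.
Qed.

Lemma isp_ext q (g h : isp K q -> R) : continuous g -> continuous h ->
  (forall y v, inclq K q y = inclH K v -> g y = h y) -> g =1 h.
Proof.
move=> gc hc gh y; apply/eqP; rewrite -subr_eq0 -normr_le0; apply/ler_addgt0Pr => e e0.
rewrite add0r; have e2 : 0 < e / 2 by rewrite divr_gt0.
have /cvgrPdist_lt/(_ _ e2)/nbhs_ballP[d1 /= d10 g1] := gc y.
have /cvgrPdist_lt/(_ _ e2)/nbhs_ballP[d2 /= d20 h1] := hc y.
have [|y' [v [yv yy']]] := @isp_dense q y (Num.min d1 d2); first by rewrite lt_min d10.
move: yy'; rewrite lt_min => /andP[yd1 yd2].
have {}g1 := g1 y'; have {}h1 := h1 y'; rewrite -!ball_normE/= in g1 h1.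
rewrite (_ : g y - h y = (g y - g y') - (h y - h y')); last first.
  by rewrite (gh _ _ yv); ring.
rewrite (le_trans (ler_normB _ _))// [leRHS]splitr lerD// ltW//; first exact: g1.
exact: h1.
Qed.

(** Choose y' from H near y. The coordinates of y' are those of y' - y, so Parseval for y' and
    Bessel for y' - y give |y'| <= |y' - y|, and hence |y| <= 2 |y - y'|. *)
Lemma isp_total q (y : isp K q) :
  (forall b, BB b -> isp_dot K q (isp_onb q b) y = 0) -> y = 0.
Proof.
have hq := @isp_hilbert _ _ _ _ _ _ K q.
move=> y0; apply/eqP; rewrite -normr_le0; apply/ler_addgt0Pr => e e0.
rewrite add0r; have e2 : 0 < e / 2 by rewrite divr_gt0.
have [y' [v [yv yy']]] := isp_dense y e2.
have : `|y'| <= `|y' - y|.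
  rewrite -(ler_pXn2r (n := 2)) ?nnegrE ?normr_ge0// -lee_fin (isp_norm_esum yv).
  apply: le_trans (bessel hq (@isp_onb_ortho q) (y' - y)).
  by apply: le_esum => b Bb; rewrite dotBr y0// subr0 (isp_dot_onb Bb yv).
rewrite distrC; have := ler_normD (y - y') y'; rewrite subrK.
lra.
Qed.

(** The factor undoes the normalization of [isp_onb], so that on H this is the plain coordinate
    [ip b v], whatever q is. *)
Definition isp_coef q b (y : isp K q) : R :=
  m b `^ (- q) * isp_dot K q (isp_onb q b) y.

Lemma isp_coefH q b y v : BB b -> inclq K q y = inclH K v -> isp_coef b y = ip b v.
Proof.
move=> Bb yv; rewrite /isp_coef (isp_dot_onb Bb yv) powRN mulKf//.
exact: eigen_powR_neq0.
Qed.

Lemma isp_dot_coef q b (y : isp K q) : BB b ->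
  isp_dot K q (isp_onb q b) y = m b `^ q * isp_coef b y.
Proof.
by move=> Bb; rewrite /isp_coef powRN mulVKf// (eigen_powR_neq0 _ Bb).
Qed.

Lemma isp_coef_continuous q b : continuous (@isp_coef q b).
Proof.
move=> y; apply: cvgM; [exact: cvg_cst|apply: dot_continuous; exact: isp_hilbert].
Qed.

Lemma isp_parseval q (y : isp K q) :
  \esum_(b in BB) ((m b `^ q * isp_coef b y) ^+ 2)%:E = (`|y| ^+ 2)%:E.
Proof.
have hq := @isp_hilbert _ _ _ _ _ _ K q.
rewrite -(parseval_total hq (@isp_onb_ortho q)) => [|u]; last exact: isp_total.
by apply: eq_esum => b Bb; rewrite isp_dot_coef.
Qed.

Lemma isp_coefD q b (y z : isp K q) : isp_coef b (y + z) = isp_coef b y + isp_coef b z.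
Proof. by rewrite /isp_coef dotDr mulrDr. Qed.

Lemma isp_coefZ q b a (y : isp K q) : isp_coef b (a *: y) = a * isp_coef b y.
Proof. by rewrite /isp_coef dotZr mulrCA. Qed.

(** Both coordinates are continuous on the smaller space and agree on the dense image of H. This
    makes [coef] well defined on the union of the scale. *)
Lemma isp_coef_nested q q' b (y : isp K q) (z : isp K q') : BB b ->
  inclq K q y = inclq K q' z -> isp_coef b y = isp_coef b z.
Proof.
move=> Bb; wlog qq' : q q' y z / q' <= q => [hw yz|yz].
  by have [/hw h|/ltW/hw h] := leP q' q; [exact: h|rewrite (h z y)].
have [f [fc ff]] := isp_nested K qq'.
have -> : z = f y by apply: (inclq_inj (i := K) (q := q')); rewrite ff.
apply: (@isp_ext q (@isp_coef q b) (fun y => isp_coef b (f y))).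
- exact: isp_coef_continuous.
- by move=> u; apply: continuous_comp; [exact: fc|exact: isp_coef_continuous].
- move=> u v uv; rewrite (isp_coefH Bb uv) (isp_coefH (v := v))//.
  by rewrite ff.
Qed.

Definition in_scale (x : ambient K) := exists q y, inclq K q y = x.

Lemma in_scale_common x x' : in_scale x -> in_scale x' ->
  exists q y y', inclq K q y = x /\ inclq K q y' = x'.
Proof.
move=> [q [y <-]] [q' [y' <-]].
have [/(isp_nested K)[f [_ ff]]|/ltW/(isp_nested K)[f [_ ff]]] := leP q q'.
  by exists q, y, (f y').
by exists q', (f y), y'.
Qed.

Definition coef b (x : ambient K) : R :=
  xget 0 [set a | exists q y, inclq K q y = x /\ a = isp_coef b y].

Lemma coef_inclq q b (y : isp K q) : BB b -> coef b (inclq K q y) = isp_coef b y.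
Proof.
move=> Bb; rewrite /coef; case: xgetP => [a _ [q' [y' [yy' ->]]]|/(_ (isp_coef b y))[]].
  exact: isp_coef_nested.
by exists q, y.
Qed.

Lemma in_scaleH v : in_scale (inclH K v).
Proof.
have [/(_ (inclH K v)) h _] := isp_neg K (ltrN10 R).
by have [|y _ yv] := h; [exists v|exists (- 1), y].
Qed.

Lemma coef_inclH b v : BB b -> coef b (inclH K v) = ip b v.
Proof.
move=> Bb; have [q [y yv]] := in_scaleH v.
by rewrite -yv coef_inclq//; exact: isp_coefH.
Qed.

Lemma in_scaleD x y : in_scale x -> in_scale y -> in_scale (x + y).
Proof.
move=> /in_scale_common/[apply] -[q [u [v [<- <-]]]].
by exists q, (u + v); rewrite linearD.
Qed.

Lemma in_scaleZ a x : in_scale x -> in_scale (a *: x).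
Proof. by move=> [q [u <-]]; exists q, (a *: u); rewrite linearZ. Qed.

Lemma coef_add b x y : BB b -> in_scale x -> in_scale y ->
  coef b (x + y) = coef b x + coef b y.
Proof.
move=> Bb /in_scale_common/[apply] -[q [u [v [<- <-]]]].
by rewrite -linearD !coef_inclq// isp_coefD.
Qed.

Lemma coef_scale b a x : BB b -> in_scale x -> coef b (a *: x) = a * coef b x.
Proof. by move=> Bb [q [u <-]]; rewrite -linearZ !coef_inclq// isp_coefZ. Qed.

(** Only the case where x is given in a larger space H_q0 needs work: Riesz-Fischer in H_q builds a
    vector with the coordinates of x, and totality in H_q0 identifies it with x. *)
Lemma range_inclq q x : in_scale x ->
  (\esum_(b in BB) ((m b `^ q * coef b x) ^+ 2)%:E < +oo)%E ->
  range (inclq K q) x.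
Proof.
move=> [q0 [y0 <-]] xq; have [/(isp_nested K)[f [_ ff]]|/ltW qq0] := leP q q0.
  by exists (f y0).
have hq := @isp_hilbert _ _ _ _ _ _ K q.
have [u [_ uc _]] := riesz_fischer hq (@isp_onb_ortho q) xq.
exists u => //; have [f [_ ff]] := isp_nested K qq0.
rewrite -ff; congr (inclq K q0 _); apply/eqP; rewrite -subr_eq0; apply/eqP/isp_total.
move=> b Bb; rewrite dotBr !isp_dot_coef// -(isp_coef_nested Bb (esym (ff u))).
have := uc b Bb; rewrite isp_dot_coef// coef_inclq//.
by move=> /(mulfI (eigen_powR_neq0 _ Bb)) ->; rewrite subrr.
Qed.

Lemma qnorm_inclq q (y : isp K q) : qnorm q (inclq K q y) = `|y|%:E.
Proof.
rewrite /qnorm (_ : [set _ | _ in _] = [set `|y|%:E]) ?ereal_inf1//.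
apply/seteqP; split=> [_ [z /(inclq_inj (i := K)) -> <-]//|_ ->].
by exists y.
Qed.

(** Outside H_q both sides are +oo, so the formula can be used without first deciding membership. *)
Lemma qnormE q x : in_scale x ->
  (qnorm q x ^+ 2 = \esum_(b in BB) ((m b `^ q * coef b x) ^+ 2)%:E)%E.
Proof.
move=> sx; have [[y _ <-]|nx] := pselect (range (inclq K q) x).
  rewrite qnorm_inclq -EFin_expe -isp_parseval; apply: eq_esum => b Bb.
  by rewrite coef_inclq.
have := contra_not (range_inclq sx) nx.
move=> /negP; rewrite -leNgt leye_eq => /eqP ->.
rewrite /qnorm (_ : [set _ | _ in _] = set0) ?ereal_inf0.
  by rewrite expe2 mulyy.
by rewrite -subset0 => z [y yx _]; apply: nx; exists y.
Qed.

Lemma qnorm_finite q x : (qnorm q x < +oo)%E -> range (inclq K q) x.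
Proof.
move=> /ereal_inf_lt[_ [y yx _] _]; by exists y.
Qed.

Lemma toH_norm x : range (inclH K) x ->
  (`|toH x| ^+ 2)%:E = \esum_(b in BB) (coef b x ^+ 2)%:E.
Proof.
move=> [v _ <-]; have -> : toH (inclH K v) = v.
  rewrite /toH; case: xgetP => [u _ /(inclH_inj (i := K))//|/(_ v)[]//].
by rewrite -(basis_parseval hip onb); apply: eq_esum => b Bb; rewrite coef_inclH.
Qed.

Lemma exp_semigroup_coord t v b : 0 <= t -> BB b ->
  ip b (exp_semigroup ip BB lam t v) = expR (t * - lam b) * ip b v.
Proof.
move=> t0 Bb; apply: (diag_op_coord hip onb _).1 => //.
apply: (bounded_diag_dom hip onb (M := expR (t * eta))) => c Bc.
rewrite ger0_norm ?expR_ge0// ler_expR ler_wpM2l// ltW//.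
by have := eigen_gt0 Bc; lra.
Qed.

(** The formula holds on H by the definition of the semigroup, and both sides are continuous on
    H_q. *)
Lemma extended_semigroup_coef S t x : extended_semigroup (K := K) S -> 0 <= t ->
  in_scale x -> in_scale (S t x) /\
  forall b, BB b -> coef b (S t x) = expR (t * - lam b) * coef b x.
Proof.
move=> extS t0 [q [y <-]]; have [SH /(_ q)[f [fc fS]]] := extS t t0.
split; first by exists q, (f y).
move=> b Bb; rewrite -fS !coef_inclq//; move: y.
apply: isp_ext => [||y v yv].
- by move=> u; apply: continuous_comp; [exact: fc|exact: isp_coef_continuous].
- by move=> u; apply: cvgM; [exact: cvg_cst|exact: isp_coef_continuous].
- rewrite (isp_coefH Bb yv) (isp_coefH (v := exp_semigroup ip BB lam t v))//.
    exact: exp_semigroup_coord.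
  by rewrite fS yv SH.
Qed.

Lemma in_scale_inclq q (y : isp K q) : in_scale (inclq K q y).
Proof. by exists q, y. Qed.

Lemma in_scale_sum n (f : 'I_n -> ambient K) : (forall i, in_scale (f i)) ->
  in_scale (\sum_(i < n) f i).
Proof.
move=> fs; elim/big_ind : _ => //; last exact: in_scaleD.
by exists 0, 0; rewrite linear0.
Qed.

Lemma coef_bigsum n (f : 'I_n -> ambient K) b : BB b -> (forall i, in_scale (f i)) ->
  coef b (\sum_(i < n) f i) = \sum_(i < n) coef b (f i).
Proof.
move=> Bb; elim: n f => [|n ih] f fs.
  rewrite !big_ord0 -[0 : ambient K](scale0r (inclH K 0)) coef_scale ?mul0r//.
  exact: in_scaleH.
rewrite !big_ord_recr/= coef_add// ?ih//; exact: in_scale_sum.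
Qed.

Lemma in_scaleB x y : in_scale x -> in_scale y -> in_scale (x - y).
Proof. by move=> sx sy; apply: in_scaleD => //; rewrite -scaleN1r; exact: in_scaleZ. Qed.

Lemma coef_sub b x y : BB b -> in_scale x -> in_scale y ->
  coef b (x - y) = coef b x - coef b y.
Proof.
move=> Bb sx sy; rewrite -scaleN1r coef_add// ?coef_scale ?mulN1r//.
exact: in_scaleZ.
Qed.

Lemma coef_sqr_le q b x : BB b -> in_scale x ->
  ((coef b x ^+ 2)%:E <= ((m b `^ q) ^- 2)%:E * qnorm q x ^+ 2)%E.
Proof.
move=> Bb sx; have mq := eigen_powR_neq0 q Bb.
have m2 : 0 < (m b `^ q) ^+ 2 by rewrite lt_neqAle eq_sym sqrf_eq0 mq sqr_ge0.
rewrite -lee_pdivrMl ?invr_gt0// invrK.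
rewrite (qnormE q sx).
apply: le_trans (esum_term (j := b) _ Bb); last by move=> c _; rewrite lee_fin sqr_ge0.
by rewrite -EFinM lee_fin exprMn.
Qed.

Lemma qnorm_ge0 q (x : ambient K) : (0 <= qnorm q x)%E.
Proof. by apply: le_ereal_inf_tmp => _ [y _ <-]; rewrite lee_fin. Qed.

Lemma HSnorm2E q (L : R -> ambient K) : HSnorm2 q L = (qnorm q (L 1%R) ^+ 2)%E.
Proof. by rewrite /HSnorm2 esum_set1// sqre_ge0. Qed.

Lemma HS_linear q (L : R -> ambient K) u : HS q L -> L u = u *: L 1.
Proof.
move=> [Llin _]; have L0 : L 0 = 0.
  by apply: (addrI (L 0)); have := Llin 1 0 0; rewrite mulr0 addr0 scale1r addr0 => <-.
by have := Llin u 1 0; rewrite mulr1 addr0 L0 addr0.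
Qed.

Lemma HS_range q (L : R -> ambient K) : HS q L -> range (inclq K q) (L 1).
Proof.
move=> [_]; rewrite HSnorm2E => h; apply: qnorm_finite.
rewrite ltNge leye_eq; apply/negP => /eqP E; move: h.
by rewrite E expe2 mulyy ltxx.
Qed.

Lemma HS_in_scale q (L : R -> ambient K) u : HS q L -> in_scale (L u).
Proof.
move=> HL; rewrite (HS_linear _ HL); apply: in_scaleZ.
by have [y _ <-] := HS_range HL; exact: in_scale_inclq.
Qed.

End Scale.

(** * Integrals of non-measurable functions *)

Section LowerIntegral.
Context {d : measure_display} {T : measurableType d} {R : realType}.
Variable mu : {measure set T -> \bar R}.
Implicit Types (D : set T) (f g : T -> \bar R).
Local Open Scope ereal_scope.

(* Integrals of nonnegative functions are suprema over simple functions below,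
   so monotonicity and the next few lemmas hold for non-measurable integrands. *)
Lemma le_lower_integral D f g : (forall x, D x -> 0 <= f x) ->
  (forall x, D x -> f x <= g x) ->
  \int[mu]_(x in D) f x <= \int[mu]_(x in D) g x.
Proof.
move=> f0 fg; have g0 x : D x -> 0 <= g x by move=> Dx; rewrite (le_trans (f0 _ Dx)) ?fg.
rewrite !ge0_integralE//; apply: le_ereal_sup => _ [h hf <-]; exists h => // x.
rewrite (le_trans (hf x))// !patchE; case: ifPn => // /set_mem; exact: fg.
Qed.

(** For a simple h below f + g, the function k = max(h - f, 0) is measurable, lies below g, and
    satisfies h <= f + k. Ordinary additivity is applied to f and k, so g may be arbitrary. *)
Lemma lower_integral_subadditive D f g : measurable D -> measurable_fun D f ->
  (forall x, D x -> 0 <= f x) -> (forall x, D x -> 0 <= g x) ->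
  \int[mu]_(x in D) (f x + g x) <= \int[mu]_(x in D) f x + \int[mu]_(x in D) g x.
Proof.
move=> mD mf f0 g0.
rewrite integral_mkcond [X in _ <= X + _]integral_mkcond [X in _ <= _ + X]integral_mkcond.
have mF : measurable_fun setT (f \_ D) by exact/(measurable_restrictT _ mD).1.
have F0 x : 0 <= (f \_ D) x by rewrite patchE; case: ifPn => // /set_mem/f0.
have G0 x : 0 <= (g \_ D) x by rewrite patchE; case: ifPn => // /set_mem/g0.
have -> : (fun x => f x + g x) \_ D = fun x => (f \_ D) x + (g \_ D) x.
  by apply/funext => x; rewrite !patchE; case: ifPn => //; rewrite adde0.
move: (f \_ D) (g \_ D) mF F0 G0 => F G mF F0 G0.
rewrite [leLHS]ge0_integralTE => [|x]; last by rewrite adde_ge0.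
apply: ge_ereal_sup => _ [h hFG <-]; rewrite -integralT_nnsfun.
pose k x := maxe ((h x)%:E - F x) 0.
have mh : measurable_fun setT (EFin \o h) by exact/measurable_EFinP.
have mk : measurable_fun setT k.
  by apply: measurable_maxe => //; exact: emeasurable_funB.
have k0 x : 0 <= k x by rewrite /k le_max lexx orbT.
apply: (@le_trans _ _ (\int[mu]_x (F x + k x))).
  apply: le_lower_integral => x _; first by rewrite lee_fin.
  rewrite /k; have := F0 x; case: (F x) => [r r0|_|//].
    by rewrite -EFinB -EFin_max -EFinD lee_fin -lerBlDl le_max lexx.
  by rewrite addye// ?leey// gt_eqF// (lt_le_trans (ltNyr 0))// le_max lexx orbT.
rewrite ge0_integralD// leeD2l//; apply: le_lower_integral => x _ //.
rewrite /k ge_max G0 andbT; have := hFG x; have := F0 x.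
case: (F x) => [r r0|_ _|//]; last by rewrite leNye.
by rewrite leeBlDl.
Qed.

Lemma le_lower_integralZl D f (k : R) : (0 < k)%R -> (forall x, D x -> 0 <= f x) ->
  \int[mu]_(x in D) (k%:E * f x) <= k%:E * \int[mu]_(x in D) f x.
Proof.
move=> k0 f0; rewrite integral_mkcond [X in _ <= _ * X]integral_mkcond.
have F0 x : 0 <= (f \_ D) x by rewrite patchE; case: ifPn => // /set_mem/f0.
have -> : (fun x => k%:E * f x) \_ D = fun x => k%:E * (f \_ D) x.
  by apply/funext => x; rewrite !patchE; case: ifPn => //; rewrite mule0.
move: (f \_ D) F0 => F F0.
rewrite [leLHS]ge0_integralTE => [|x]; last by rewrite mule_ge0// lee_fin ltW.
apply: ge_ereal_sup => _ [h hF <-]; rewrite -integralT_nnsfun.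
have mh : measurable_fun setT (EFin \o h) by exact/measurable_EFinP.
rewrite -lee_pdivrMl// -ge0_integralZl//; last 2 first.
- by move=> x _; rewrite lee_fin.
- by rewrite lee_fin invr_ge0 ltW.
apply: le_lower_integral => x _.
  by rewrite mule_ge0// lee_fin// invr_ge0 ltW.
by rewrite lee_pdivrMl//; exact: hF.
Qed.

Lemma ge_lower_integralZl D f (k : R) : (0 <= k)%R -> (forall x, D x -> 0 <= f x) ->
  k%:E * \int[mu]_(x in D) f x <= \int[mu]_(x in D) (k%:E * f x).
Proof.
rewrite le_eqVlt => /predU1P[<-|k0] f0.
  by rewrite mul0e; apply: integral_ge0 => x _; rewrite mul0e.
rewrite -lee_pdivlMl//; apply: (le_trans _ (le_lower_integralZl _ _)).
- apply: le_lower_integral => x Dx; first exact: f0.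
  by rewrite muleA -EFinM mulVf ?gt_eqF// mul1e.
- by rewrite invr_gt0.
- by move=> x Dx; rewrite mule_ge0 ?f0// lee_fin ltW.
Qed.

(** The form in which Young's inequality is integrated: g is the measurable comparison function, h
    an error term of unknown measurability. *)
Lemma lower_integral_combination D f g (h : T -> \bar R) (a b : R) :
  measurable D -> (0 < a)%R -> (0 < b)%R -> measurable_fun D g ->
  (forall x, D x -> 0 <= f x) -> (forall x, D x -> 0 <= g x) ->
  (forall x, D x -> 0 <= h x) ->
  (forall x, D x -> f x <= a%:E * g x + b%:E * h x) ->
  \int[mu]_(x in D) f x <=
    a%:E * \int[mu]_(x in D) g x + b%:E * \int[mu]_(x in D) h x.
Proof.
move=> mD a0 b0 mg f0 g0 h0 fgh.
apply: (le_trans (le_lower_integral f0 fgh)).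
apply: (le_trans (lower_integral_subadditive mD _ _ _)).
- by apply: emeasurable_funM.
- by move=> x Dx; rewrite mule_ge0 ?g0// lee_fin ltW.
- by move=> x Dx; rewrite mule_ge0 ?h0// lee_fin ltW.
by rewrite ge0_integralZl ?lee_fin ?(ltW a0)// leeD2l// le_lower_integralZl.
Qed.

Lemma ae_le_lower_integral f g : measurable_fun setT f -> (forall x, 0 <= f x) ->
  (forall x, 0 <= g x) -> {ae mu, forall x, f x <= g x} ->
  \int[mu]_x f x <= \int[mu]_x g x.
Proof.
move=> mf f0 g0 [N [mN N0 fgN]].
rewrite (_ : \int[mu]_x f x = \int[mu]_x (f \_ (~` N)) x).
  apply: le_lower_integral => x _; rewrite patchE; case: ifPn => // /set_mem Nx.
  by apply: contrapT => fg; apply: Nx; apply: fgN.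
rewrite -integral_mkcond -setTD.
by apply: ge0_negligible_integral.
Qed.

(** Raising f to +oo on a measurable null set keeps its integral and makes it dominate g everywhere,
    so that monotonicity applies. *)
Lemma ae_ge_lower_integral f g : measurable_fun setT f -> (forall x, 0 <= f x) ->
  (forall x, 0 <= g x) -> {ae mu, forall x, g x <= f x} ->
  \int[mu]_x g x <= \int[mu]_x f x.
Proof.
move=> mf f0 g0 [N [mN N0 fgN]].
pose h x := f x + (+oo%E * (\1_N x)%:E).
have mi : measurable_fun setT (fun x => (+oo%E : \bar R) * (\1_N x)%:E).
  by apply: emeasurable_funM => //; apply/measurable_EFinP; exact: measurable_indic.
have i0 x : 0 <= (+oo%E : \bar R) * (\1_N x)%:E by rewrite mule_ge0// lee_fin.
apply: (@le_trans _ _ (\int[mu]_x h x)).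
  apply: le_lower_integral => x _ //; rewrite /h indicE.
  have [xN|xN] := boolP (x \in N).
    by rewrite mule1 addey ?leey// gt_eqF// (lt_le_trans _ (f0 x)).
  rewrite mule0 adde0; apply: contrapT => fg; move/negP: xN; apply.
  by apply/mem_set/fgN.
rewrite /h ge0_integralD// ge0_integralZl//; last first.
- by apply/measurable_EFinP; exact: measurable_indic.
by rewrite integral_indic// setIT N0 mule0 adde0.
Qed.

End LowerIntegral.

(** * Exchanging countable unordered sums with integrals *)

Section IntegralEsum.
Context {d : measure_display} {T : measurableType d} {R : realType} {J : pointedType}.
Variable mu : {measure set T -> \bar R}.
Local Open Scope ereal_scope.

(** One enumeration serves all summands f, so a sum of functions becomes a series of functions to
    which monotone convergence applies. The predicate [B] also covers finite index sets. *)
Lemma countable_esum_series (D : set J) : countable D ->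
  exists (B : pred nat) (e : nat -> J), (forall n, B n -> D (e n)) /\
    forall f : J -> \bar R, (forall j, D j -> 0 <= f j) ->
    \esum_(j in D) f j = \sum_(0 <= n <oo) (if B n then f (e n) else 0).
Proof.
move=> /countable_bijP[B]; rewrite card_eq_sym => /card_set_bijP[e eB].
exists (fun n => n \in B), e; have eD n : n \in B -> D (e n).
  by move=> /set_mem Bn; have [eBD _ _] := eB; exact: eBD.
split=> // f f0; rewrite (reindex_esum _ _ _ _ eB) esum_mkcond nneseries_esumT//.
by move=> n; case: ifP => // /eD/f0.
Qed.

Variables (D : set J) (E : set T).
Hypotheses (cD : countable D) (mE : measurable E).
Variable f : J -> T -> \bar R.
Hypothesis f0 : forall j x, D j -> 0 <= f j x.
Hypothesis mf : forall j, D j -> measurable_fun E (f j).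

Lemma measurable_esum : measurable_fun E (fun x => \esum_(j in D) f j x).
Proof.
have [B [e [BD eE]]] := countable_esum_series cD.
rewrite (_ : (fun x => _) = (fun x => \sum_(0 <= n <oo) (if B n then f (e n) x else 0))).
  apply: ge0_emeasurable_sum => [n x _ _|n _]; first by case: ifP => // /BD/f0.
  by have [/BD/mf|_] := boolP (B n).
by apply/funext => x; rewrite eE// => j /f0.
Qed.

Lemma integral_esum : \int[mu]_(x in E) (\esum_(j in D) f j x) =
  \esum_(j in D) \int[mu]_(x in E) f j x.
Proof.
have [B [e [BD eE]]] := countable_esum_series cD.
rewrite (eq_integral (fun x => \sum_(0 <= n <oo) (if B n then f (e n) x else 0))).
  rewrite integral_nneseries//.
  - rewrite eE => [|j Dj]; last by apply: integral_ge0 => x _; exact: f0.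
    by apply: eq_eseriesr => n _; case: ifP => //; rewrite integral0.
  - by move=> n; have [/BD/mf|_] := boolP (B n).
  - by move=> n x _; case: ifP => // /BD/f0.
by move=> x _; apply: eE => j /f0.
Qed.

End IntegralEsum.

(** * Normal laws and independence *)

Section Density.
Context {d : measure_display} {T : measurableType d} {R : realType}.
Variables (nu mu : {measure set T -> \bar R}) (f : T -> R).
Hypothesis f0 : forall x, 0 <= f x.
Hypothesis mf : measurable_fun setT f.
Hypothesis nuE : forall A, measurable A -> nu A = (\int[mu]_(x in A) (f x)%:E)%E.
Local Open Scope ereal_scope.

Let mfE : measurable_fun setT (EFin \o f).
Proof. exact/measurable_EFinP. Qed.

Let integral_density_indic E : measurable E ->
  \int[nu]_x (\1_E x)%:E = \int[mu]_x ((\1_E x)%:E * (f x)%:E).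
Proof.
move=> mE; rewrite integral_indic// setIT nuE// integral_mkcond.
apply: eq_integral => x _; rewrite patchE indicE.
by case: ifPn => xE; rewrite ?mul1e ?mul0e.
Qed.

Let integral_density_nnsfun (g : {nnsfun T >-> R}) :
  \int[nu]_x (g x)%:E = \int[mu]_x ((g x)%:E * (f x)%:E).
Proof.
under [LHS]eq_integral do rewrite fimfunE -fsumEFin//.
rewrite [LHS]ge0_integral_fsum//; last 2 first.
  - by move=> r; exact/measurable_EFinP/measurableT_comp.
  - by move=> n x _; rewrite EFinM nnfun_muleindic_ge0.
under [RHS]eq_integral.
  move=> x xD; rewrite fimfunE -fsumEFin// ge0_mule_fsuml; last first.
    by move=> r; rewrite EFinM nnfun_muleindic_ge0.
  over.
rewrite [RHS]ge0_integral_fsum//; last 2 first.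
  - move=> r; apply: emeasurable_funM => //.
    by apply/measurable_EFinP; apply/measurableT_comp.
  - move=> n x _; apply: mule_ge0; last by rewrite lee_fin.
    by rewrite EFinM nnfun_muleindic_ge0.
apply: eq_fsbigr => r; rewrite inE/= => -[x0 _ gr].
have r0 : (0 <= r)%R by rewrite -gr.
have mi : measurable_fun setT (fun x => (\1_(g @^-1` [set r]) x)%:E : \bar R).
  by apply/measurable_EFinP; exact: measurable_indic.
under eq_integral do rewrite EFinM; under [RHS]eq_integral do rewrite EFinM -muleA.
rewrite !ge0_integralZl//.
- by rewrite integral_density_indic.
- by apply: emeasurable_funM.
- by move=> x _; rewrite mule_ge0// lee_fin.
Qed.

(** Indicators, then simple functions, then monotone limits. *)
Lemma ge0_integral_density (g : T -> \bar R) : measurable_fun setT g ->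
  (forall x, 0 <= g x) -> \int[nu]_x g x = \int[mu]_x (g x * (f x)%:E).
Proof.
move=> mg g0; pose g_ := nnsfun_approx measurableT mg.
transitivity (lim (\int[nu]_x (g_ n x)%:E @[n --> \oo])).
  rewrite -monotone_convergence//=.
  - apply: eq_integral => x _; apply/esym/cvg_lim => //.
    exact: cvg_nnsfun_approx.
  - by move=> n; exact/measurable_EFinP/measurable_funTS.
  - by move=> n x _; rewrite lee_fin.
  - by move=> x _ a b ab; rewrite lee_fin; exact/lefP/nd_nnsfun_approx.
transitivity (lim (\int[mu]_x ((g_ n x)%:E * (f x)%:E) @[n --> \oo])).
  by apply: congr_lim; apply/funext => n; exact: integral_density_nnsfun.
rewrite -monotone_convergence//=.
- apply: eq_integral => x _; apply/cvg_lim => //.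
  by apply: cvgeZr => //; exact: cvg_nnsfun_approx.
- move=> n; apply: emeasurable_funM => //.
  exact/measurable_EFinP/measurable_funTS.
- by move=> n x _; rewrite mule_ge0// lee_fin.
- move=> x _ a b ab; rewrite lee_wpmul2r ?lee_fin//.
  exact/lefP/nd_nnsfun_approx.
Qed.

End Density.

(** * Second moment of the centred normal density *)

Section GaussMoments.
Context {R : realType}.
Local Notation mu := (@lebesgue_measure R).
Variable s : R.
Hypothesis s0 : 0 < s.

Let p := @normal_pdf R 0 s.

Let pE x : p x = normal_peak s * expR (- x ^+ 2 / (s ^+ 2 *+ 2)).
Proof. by rewrite /p normal_pdfE ?gt_eqF// /normal_fun subr0. Qed.

Let p_continuous : continuous p.
Proof. by apply: continuous_normal_pdf; rewrite gt_eqF. Qed.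

Let p0 x : 0 <= p x.
Proof. exact: normal_pdf_ge0. Qed.

Let pN x : p (- x) = p x.
Proof. by rewrite !pE sqrrN. Qed.

Let s22 : 0 < s ^+ 2 *+ 2.
Proof. by rewrite pmulrn_rgt0// exprn_gt0. Qed.

Let p_derive (x : R) : is_derive x (1 : R) (fun y => - s ^+ 2 * p y) (x * p x).
Proof.
pose a := - (s ^+ 2 *+ 2)^-1.
have E y : expR (- y ^+ 2 / (s ^+ 2 *+ 2)) = expR (a * y ^+ 2).
  by congr expR; rewrite /a; ring.
have -> : (fun y => - s ^+ 2 * p y) =
   (- s ^+ 2 * normal_peak s) \*: (expR \o (a \*: (@id R ^+ 2))).
  by apply/funext => y; rewrite /= pE E mulrA.
have -> : x * p x = (- s ^+ 2 * normal_peak s) *: (expR (a *: (x ^+ 2)) *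
   (a *: ((2%:R * x ^+ 1) *: 1))).
  rewrite pE E /GRing.scale/= mulr1 expr1 /a.
  by field; rewrite gt_eqF.
apply: is_deriveZ; apply: is_derive1_comp.
Qed.

Let p_cvg0 : p x @[x --> +oo] --> (0 : R).
Proof.
have -> : p = (fun x => normal_peak s *
    (gauss_fun \o (fun x => (Num.sqrt (s ^+ 2 *+ 2))^-1 * x)) x).
  apply/funext => x; rewrite pE /gauss_fun/= exprMn exprVn sqr_sqrtr ?(ltW s22)//.
  by congr (_ * expR _); ring.
rewrite -(mulr0 (normal_peak s)); apply: cvgM; first exact: cvg_cst.
apply: cvg_comp cvg_gauss_fun; apply: gt0_cvgMry; last exact: cvg_id.
by rewrite invr_gt0 sqrtr_gt0.
Qed.

Let tail y : 0 <= y ->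
  (\int[mu]_(x in `[y, +oo[) (x * p x)%:E = (s ^+ 2 * p y)%:E :> \bar R)%E.
Proof.
move=> y0; rewrite (ge0_continuous_FTC2y (F := fun y => - s ^+ 2 * p y) (l := 0)).
- by rewrite sub0e -EFinN mulNr opprK.
- by move=> x yx; rewrite mulr_ge0// (le_trans y0).
- apply: continuous_subspaceT => x; apply: cvgM; [exact: cvg_id|exact: p_continuous].
- rewrite -(mulr0 (- s ^+ 2)); apply: cvgM; [exact: cvg_cst|exact: p_cvg0].
- by move=> x _; have [] := p_derive x.
- apply: cvg_at_right_filter; apply: cvgM; [exact: cvg_cst|exact: p_continuous].
- by move=> x _; rewrite derive1E; have [_ ->] := p_derive x.
Qed.

Let measurable_p : measurable_fun setT p.
Proof. exact: measurable_normal_pdf. Qed.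

(** Integration by parts done with Tonelli: x^2 p(x) is the integral of x p(x) over y in [0, x].
    Integrating in x first leaves the tail integral of x p(x) beyond y, which is s^2 p(y) because -
    s^2 p is an antiderivative of x p(x). *)
Let half : (\int[mu]_(x in [set x | (0 <= x)%R]) (x ^+ 2 * p x)%:E =
  (s ^+ 2)%:E * \int[mu]_(x in [set x | (0 <= x)%R]) (p x)%:E :> \bar R)%E.
Proof.
pose k (z : R * R) := if (0 <= z.2) && (z.2 <= z.1) then (z.1 * p z.1)%:E else 0%E : \bar R.
have mk : measurable_fun setT k.
  apply: measurable_fun_ifT => //.
    by apply: measurable_and; apply: measurable_fun_ler.
  apply/measurable_EFinP; apply: measurable_funM => //.
  exact: measurableT_comp.
have k0 z : (0 <= k z)%E.
  rewrite /k; case: ifPn => // /andP[z2 z21].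
  by rewrite lee_fin mulr_ge0// (le_trans z2).
have := @fubini_tonelli _ _ _ _ R mu mu k mk k0.
rewrite [X in X = _ -> _](_ : _ =
   \int[mu]_(x in [set x | (0 <= x)%R]) (x ^+ 2 * p x)%:E)%E; last first.
  rewrite [RHS]integral_mkcond; apply: eq_integral => x _.
  rewrite patchE; case: ifPn => [|]; rewrite ?inE ?notin_setE/= => x0.
    rewrite (_ : (fun y => k (x, y)) = (cst (x * p x)%:E) \_ `[0, x]).
      rewrite -integral_mkcond integral_cst//= lebesgue_measure_itv/= lte_fin.
      move: x0; rewrite le_eqVlt => /predU1P[<-|x0]; first by rewrite mul0r mul0e expr0n mul0r.
      by rewrite x0 oppr0 adde0 -EFinM; congr EFin; ring.
    apply/funext => y; rewrite patchE /k/=; congr (if _ then _ else _).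
    by apply/idP/idP; rewrite inE/= in_itv.
  apply: integral0_eq => y _; rewrite /k/=; case: ifPn => // /andP[y0 yx].
  by move: x0; rewrite (le_trans y0 yx).
move=> ->; rewrite -ge0_integralZl//; last 4 first.
- by rewrite -set_itvcy.
- by apply/measurable_EFinP/measurable_funTS.
- by move=> x _; rewrite lee_fin.
- by rewrite lee_fin sqr_ge0.
rewrite [RHS]integral_mkcond; apply: eq_integral => y _.
rewrite patchE; case: ifPn => [|]; rewrite ?inE ?notin_setE/= => y0; last first.
  by apply: integral0_eq => x _; rewrite /k/=; move/negP/negbTE: y0 => ->.
rewrite -EFinM -tail// [RHS]integral_mkcond; apply: eq_integral => x _.
rewrite patchE /k/= y0/=; congr (if _ then _ else _).
by apply/idP/idP; rewrite inE/= in_itv/= andbT.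
Qed.

Lemma normal_pdf_second_moment :
  (\int[mu]_x (x ^+ 2 * normal_pdf 0 s x)%:E = (s ^+ 2)%:E :> \bar R)%E.
Proof.
rewrite (ge0_symfun_integralT (f := fun x => x ^+ 2 * p x)); last 3 first.
- by move=> x; rewrite mulr_ge0 ?sqr_ge0.
- by move=> x; apply: cvgM; [exact: exprn_continuous|exact: p_continuous].
- by move=> x /=; rewrite sqrrN pN.
rewrite half muleCA -(ge0_symfun_integralT (f := p))//.
  by rewrite integral_normal_pdf mule1.
by move=> x /=; rewrite pN.
Qed.

End GaussMoments.

Lemma ge0_integral_opp {R : realType} (g : R -> \bar R) : measurable_fun setT g ->
  (forall x, 0 <= g x)%E ->
  (\int[lebesgue_measure]_x g (- (x : R))%R = \int[lebesgue_measure]_x g x)%E.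
Proof.
move=> mg g0.
have := @ge0_integral_pushforward _ _ _ _ R (-%R : measurableTypeR R -> measurableTypeR R)
  (@oppr_measurable _ _) lebesgue_measure setT g measurableT mg (fun x _ => g0 x).
rewrite preimage_setT => <-.
by apply: eq_measure_integral => A mA _; exact: lebesgue_measureN.
Qed.

Section SquareIntegrable.
Context {d : measure_display} {T : measurableType d} {R : realType}.
Variable P : probability T R.
Local Open Scope ereal_scope.

Lemma sqr_integrable (f : T -> R) : measurable_fun setT f ->
  \int[P]_x (f x ^+ 2)%:E < +oo -> P.-integrable setT (EFin \o f).
Proof.
move=> mf f2; apply/integrableP; split; first exact/measurable_EFinP.
apply: (@le_lt_trans _ _ (\int[P]_x (1 + (f x ^+ 2)%:E))).
  apply: ge0_le_integral => //.
  - by do 2 apply: measurableT_comp => //.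
  - by apply: emeasurable_funD => //; apply/measurable_EFinP/measurable_funX.
  - move=> x _; rewrite /= -EFinD lee_fin.
    by have := sqr_ge0 (`|f x| - 1); rewrite -(real_normK (num_real (f x))); nra.
rewrite ge0_integralD//; last 2 first.
- by move=> x _; rewrite lee_fin sqr_ge0.
- exact/measurable_EFinP/measurable_funX.
have -> : \int[P]_(x in setT) (1 : \bar R) = 1.
  by rewrite integral_cst//= mul1e; exact: probability_setT.
by rewrite lte_add_pinfty// ltry.
Qed.

Lemma integrable_mul_sqr (f g : T -> R) :
  measurable_fun setT f -> measurable_fun setT g ->
  \int[P]_x (f x ^+ 2)%:E < +oo -> \int[P]_x (g x ^+ 2)%:E < +oo ->
  P.-integrable setT (fun x => (f x * g x)%:E).
Proof.
move=> mf mg f2 g2; apply/integrableP; split; first exact/measurable_EFinP/measurable_funM.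
apply: (@le_lt_trans _ _ (\int[P]_x ((f x ^+ 2)%:E + (g x ^+ 2)%:E))).
  apply: ge0_le_integral => //.
  - do 2 apply: measurableT_comp => //; exact: measurable_funM.
  - by apply: emeasurable_funD => //; apply/measurable_EFinP/measurable_funX.
  - move=> x _; rewrite /= -EFinD lee_fin normrM.
    rewrite -(real_normK (num_real (f x))) -(real_normK (num_real (g x))).
    by have := sqr_ge0 (`|f x| - `|g x|); nra.
rewrite ge0_integralD//.
- exact: lte_add_pinfty.
- by move=> x _; rewrite lee_fin sqr_ge0.
- exact/measurable_EFinP/measurable_funX.
- by move=> x _; rewrite lee_fin sqr_ge0.
- exact/measurable_EFinP/measurable_funX.
Qed.

End SquareIntegrable.

Section NormalLaw.
Context {d : measure_display} {T : measurableType d} {R : realType}.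
Variables (P : probability T R) (Y : T -> R) (s : R).
Hypotheses (mY : measurable_fun setT Y) (s0 : 0 < s).
Hypothesis lawY : forall U : set R, measurable U -> P (Y @^-1` U) = normal_prob 0 s U.

Lemma ge0_expectation_normal (g : R -> \bar R) : measurable_fun setT g ->
  (forall x, 0 <= g x)%E ->
  (\int[P]_x g (Y x) = \int[lebesgue_measure]_x (g x * (normal_pdf 0 s x)%:E))%E.
Proof.
move=> mg g0.
have := @ge0_integral_pushforward _ _ _ _ R (Y : T -> measurableTypeR R) mY P setT g
  measurableT mg (fun x _ => g0 x).
rewrite preimage_setT => <-.
have <- := @ge0_integral_density _ _ R (normal_prob 0 s) lebesgue_measure
  (normal_pdf 0 s) (normal_pdf_ge0 0 s) (measurable_normal_pdf 0 s)
  (fun A _ => erefl) g mg g0.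
by apply: eq_measure_integral => A mA _; exact: lawY.
Qed.

Lemma normal_second_moment : (\int[P]_x (Y x ^+ 2)%:E = (s ^+ 2)%:E)%E.
Proof.
rewrite (@ge0_expectation_normal (fun y => (y ^+ 2)%:E)).
- by rewrite -normal_pdf_second_moment//; apply: eq_integral => x _; rewrite EFinM.
- by apply/measurable_EFinP; exact: measurable_funX.
- by move=> x; rewrite lee_fin sqr_ge0.
Qed.

Lemma normal_integrable : P.-integrable setT (EFin \o Y).
Proof. by apply: sqr_integrable => //; rewrite normal_second_moment ltry. Qed.

(** The density is even, so positive and negative parts have the same integral; integrability makes
    it finite, so the difference is 0. *)
Lemma normal_mean0 : (\int[P]_x (Y x)%:E = 0)%E.
Proof.
pose g (y : R) := maxe y%:E 0%E.
have mg : measurable_fun setT g by apply: measurable_maxe => //; exact/measurable_EFinP.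
have g0 x : (0 <= g x)%E by rewrite /g le_max lexx orbT.
have mgN : measurable_fun setT (fun y : R => g (- y)).
  by apply: (measurableT_comp mg); exact: oppr_measurable.
rewrite integralE.
have E1 : (\int[P]_x (fun x => (Y x)%:E)^\+ x = \int[P]_x g (Y x))%E.
  by apply: eq_integral => x _; rewrite !funeposE.
have E2 : (\int[P]_x (fun x => (Y x)%:E)^\- x = \int[P]_x g (- Y x)%R)%E.
  by apply: eq_integral => x _; rewrite funenegE /g EFinN.
have E3 : (\int[P]_x g (- Y x)%R = \int[P]_x g (Y x))%E.
  apply: (etrans (ge0_expectation_normal mgN (fun x => g0 (- x)))).
  apply: (etrans _ (esym (ge0_expectation_normal mg g0))).
  have mgp : measurable_fun setT (fun x : R => (g x * (normal_pdf 0 s x)%:E)%E).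
    apply: emeasurable_funM => //; apply/measurable_EFinP.
    exact: (measurable_normal_pdf 0 s).
  apply: (etrans _ (ge0_integral_opp mgp _)).
  - apply: eq_integral => x _; congr (_ * _%:E)%E.
    by rewrite !normal_pdfE ?gt_eqF// /normal_fun !subr0 sqrrN.
  - by move=> x; rewrite mule_ge0// lee_fin normal_pdf_ge0.
rewrite E2 E3 -E1 subee//.
by apply: integrable_pos_fin_num => //; exact: normal_integrable.
Qed.

End NormalLaw.

(** * Expectation of a product of independent variables *)

Section Independence.
Context {d : measure_display} {T : measurableType d} {R : realType}.
Variables (P : probability T R) (Z Y : T -> R).
Hypotheses (mZ : measurable_fun setT Z) (mY : measurable_fun setT Y).
Hypothesis indep : forall A B : set R, measurable A -> measurable B ->
  P (Z @^-1` A `&` Y @^-1` B) = (P (Z @^-1` A) * P (Y @^-1` B))%E.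
Local Open Scope ereal_scope.

Let Z' : {mfun T >-> R} :=
  HB.pack Z (isMeasurableFun.Build _ _ _ _ _ mZ).
Let Y' : {mfun T >-> R} :=
  HB.pack Y (isMeasurableFun.Build _ _ _ _ _ mY).
Let nuZ := distribution P Z'.
Let nuY := distribution P Y'.

(** Independence says that the joint law agrees with the product of the marginals on rectangles, and
    a product measure is determined there. *)
Let law_pair (g : R * R -> \bar R) : measurable_fun setT g -> (forall z, 0 <= g z) ->
  \int[P]_x g (Z x, Y x) = \int[nuZ \x nuY]_z g z.
Proof.
move=> mg g0.
have mZY : measurable_fun setT (fun x => (Z x, Y x)) by exact: measurable_fun_pair.
have := @ge0_integral_pushforward _ _ _ _ R _ mZY P setT g measurableT mg (fun x _ => g0 x).
rewrite preimage_setT => <-.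
apply: eq_measure_integral => A mA _; apply/esym.
apply: (@product_measure_unique _ _ _ _ R nuZ nuY) => //.
Qed.

Lemma indep_ge0_integralM : \int[P]_x `|(Z x * Y x)%:E| =
  \int[P]_x `|(Z x)%:E| * \int[P]_x `|(Y x)%:E|.
Proof.
rewrite (law_pair (g := fun z => `|(z.1 * z.2)%:E|))//; last first.
  by apply: measurableT_comp => //; apply/measurable_EFinP/measurable_funM.
rewrite fubini_tonelli1//; last first.
  by apply: measurableT_comp => //; apply/measurable_EFinP/measurable_funM.
rewrite /fubini_F/=.
transitivity (\int[nuZ]_x (`|x%:E| * \int[nuY]_y `|y%:E|)).
  apply: eq_integral => x _; rewrite -ge0_integralZl//.
  - by apply: eq_integral => y _; rewrite /= normrM EFinM.
  - by apply: measurableT_comp => //; exact/measurable_EFinP.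
rewrite ge0_integralZr//.
- by rewrite !ge0_integral_distribution//; do 2 apply: measurableT_comp => //.
- by apply: measurableT_comp => //; exact/measurable_EFinP.
- by apply: integral_ge0.
Qed.

Hypotheses (iZ : P.-integrable setT (EFin \o Z)) (iY : P.-integrable setT (EFin \o Y)).

Lemma indep_integrableM : P.-integrable setT (fun x => (Z x * Y x)%:E).
Proof.
apply/integrableP; split; first exact/measurable_EFinP/measurable_funM.
rewrite indep_ge0_integralM lte_mul_pinfty//.
- by apply: integral_ge0.
- by have /integrableP[_] := iZ; rewrite -ge0_fin_numE//; exact: integral_ge0.
- by have /integrableP[_] := iY.
Qed.

Lemma indep_integralM : \int[P]_x (Z x * Y x)%:E =
  \int[P]_x (Z x)%:E * \int[P]_x (Y x)%:E.
Proof.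
have mM : measurable_fun setT (fun z : R * R => (z.1 * z.2)%:E).
  by apply/measurable_EFinP/measurable_funM.
have law (f : R * R -> \bar R) : measurable_fun setT f ->
    P.-integrable setT (fun x => f (Z x, Y x)) ->
    \int[P]_x f (Z x, Y x) = \int[nuZ \x nuY]_z f z.
  move=> mf _; rewrite integralE [RHS]integralE; congr (_ - _).
    rewrite -(law_pair (measurable_funepos mf)) => [|z]; last exact: funepos_ge0.
    by apply: eq_integral => x _; rewrite !funeposE.
  rewrite -(law_pair (measurable_funeneg mf)) => [|z]; last exact: funeneg_ge0.
  by apply: eq_integral => x _; rewrite !funenegE.
rewrite (law (fun z => (z.1 * z.2)%:E))//; last exact: indep_integrableM.
have iM : (nuZ \x nuY).-integrable setT (fun z : R * R => (z.1 * z.2)%:E).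
  apply/integrableP; split => //.
  have /integrableP[_] := indep_integrableM.
  rewrite (law_pair (g := fun z => `|(z.1 * z.2)%:E|))//.
  by apply: measurableT_comp.
have nZ : nuZ.-integrable setT EFin.
  apply/integrableP; split; first exact/measurable_EFinP.
  rewrite ge0_integral_distribution//; last first.
    by apply: measurableT_comp => //; exact/measurable_EFinP.
  by have /integrableP[_] := iZ.
have nY : nuY.-integrable setT EFin.
  apply/integrableP; split; first exact/measurable_EFinP.
  rewrite ge0_integral_distribution//; last first.
    by apply: measurableT_comp => //; exact/measurable_EFinP.
  by have /integrableP[_] := iY.
have EY : \int[nuY]_y y%:E = \int[P]_x (Y x)%:E.
  by rewrite integral_distribution//; exact/measurable_EFinP.
have EZ : \int[nuZ]_y y%:E = \int[P]_x (Z x)%:E.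
  by rewrite integral_distribution//; exact/measurable_EFinP.
have Yfin : \int[nuY]_y y%:E \is a fin_num by apply: integrable_fin_num.
rewrite -integral12_prod_meas1// /fubini_F/= -EY -EZ -(fineK Yfin).
rewrite -[RHS]integralZr//; apply: eq_integral => x _.
by rewrite (fineK Yfin) -integralZl.
Qed.

End Independence.

Section Mean.
Context {d : measure_display} {T : measurableType d} {R : realType}.
Variables (mu : {measure set T -> \bar R}) (D : set T).
Hypothesis mD : measurable D.
Implicit Types (f g : T -> R) (c e : R).

(** Bundling integrability with a finite value lets expansions into many products be integrated term
    by term, without side conditions in the extended reals. *)
Definition has_mean f c :=
  mu.-integrable D (EFin \o f) /\ (\int[mu]_(x in D) (f x)%:E = c%:E)%E.

Lemma has_mean0 : has_mean (fun=> 0) 0.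
Proof. by split; [exact: integrable0|exact: integral0]. Qed.

Lemma eq_has_mean f g c : f =1 g -> has_mean f c -> has_mean g c.
Proof. by move=> /funext ->. Qed.

Lemma has_meanD f g c e : has_mean f c -> has_mean g e ->
  has_mean (fun x => f x + g x) (c + e).
Proof.
move=> [fi fc] [gi ge]; split.
  have -> : EFin \o (fun x => f x + g x) = (EFin \o f) \+ (EFin \o g) by apply/funext.
  exact: integrableD.
under eq_integral do rewrite EFinD.
by rewrite integralD// fc ge EFinD.
Qed.

Lemma has_meanZ k f c : has_mean f c -> has_mean (fun x => k * f x) (k * c).
Proof.
move=> [fi fc]; split.
  have -> : EFin \o (fun x => k * f x) = (fun x => k%:E * (EFin \o f) x)%E by apply/funext.
  exact: integrableZl.
under eq_integral do rewrite EFinM.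
by rewrite integralZl// fc EFinM.
Qed.

Lemma has_mean_sum n (f : 'I_n -> T -> R) (c : 'I_n -> R) :
  (forall i, has_mean (f i) (c i)) ->
  has_mean (fun x => \sum_(i < n) f i x) (\sum_(i < n) c i).
Proof.
elim: n f c => [|n IHn] f c fc.
  rewrite big_ord0; apply: eq_has_mean has_mean0 => x.
  by rewrite big_ord0.
rewrite big_ord_recl.
apply: eq_has_mean (has_meanD (fc ord0) (IHn _ _ (fun i => fc (lift ord0 i)))).
by move=> x; rewrite big_ord_recl.
Qed.

End Mean.

Section MeanIndicator.
Context {d : measure_display} {T : measurableType d} {R : realType}.
Variable P : probability T R.

Lemma integrable_has_mean (f : T -> R) :
  P.-integrable setT (EFin \o f) -> exists c, has_mean P setT f c.
Proof.
move=> fi; exists (fine (\int[P]_x (f x)%:E)%E); split=> //; rewrite fineK//.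
exact: integrable_fin_num.
Qed.

Lemma has_mean_indicM (C : set T) (f : T -> R) : measurable C ->
  P.-integrable setT (EFin \o f) -> exists c, has_mean P setT (fun x => \1_C x * f x) c.
Proof.
move=> mC fi; have /integrableP[/measurable_EFinP mf _] := fi.
apply: integrable_has_mean; apply: le_integrable fi => //.
  by apply/measurable_EFinP/measurable_funM; first exact: measurable_indic.
move=> x _; rewrite lee_fin/= normrM ger0_norm ?indicE//.
by case: (x \in C); rewrite ?mul1r ?mul0r.
Qed.

End MeanIndicator.

(** * Elementary stochastic integrals *)

Section BorelMeasurable.
Context {R : realType} {d : measure_display} {Omega : measurableType d}.
Implicit Types (G : set (set Omega)).

Lemma borel_measurable_comp G (U V : topologicalType)
    (f : Omega -> U) (g : U -> V) :
  continuous g -> borel_measurable G f -> borel_measurable G (g \o f).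
Proof.
move=> gc fG B sB; apply: (fG (g @^-1` B)).
have sig := smallest_sigma_algebra [set: U] (open : set (set U)).
suff : <<s open >> `<=` image_set_system setT g <<s open >>.
  by move=> /(_ B sB); rewrite /image_set_system/= setTI.
apply: smallest_sub; first exact: sigma_algebra_image.
move=> O oO; rewrite /image_set_system/= setTI; apply: sub_sigma_algebra.
by apply: open_comp => // x _; exact: gc.
Qed.

Lemma borel_measurable_preimage G (f : Omega -> R) (B : set R) :
  borel_measurable G f -> measurable B -> G (f @^-1` B).
Proof.
move=> fG mB; apply: fG.
have : (RGenOpens.G (R := R)).-sigma.-measurable B.
  by rewrite -RGenOpens.measurableE; exact: mB.
apply: sub_sigma_algebra2 => _ [x [y ->]].
exact: interval_open.
Qed.

Lemma borel_measurable_fun (f : Omega -> R) :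
  borel_measurable measurable f -> measurable_fun setT f.
Proof. by move=> fB _ B mB; rewrite setTI; exact: borel_measurable_preimage. Qed.

End BorelMeasurable.

(** * Moments of Brownian increments against adapted factors *)

Section BrownianIncrements.
Context {R : realType} {d : measure_display} {Omega : measurableType d}.
Variables (P : probability Omega R) (T : R) (F : R -> set (set Omega)).
Hypothesis normalF : normal_filtration P T F.
Variable W : R -> Omega -> R.
Hypothesis bm : brownian_motion P T F W.

(** Although [F s] is already a sigma-algebra, it is passed through the generated one to obtain a
    measurable type, on which closure under products and differences is available. *)
Definition adapted s (Z : Omega -> R) :=
  measurable_fun setT (Z : g_sigma_algebraType (F s) -> R).

Let sigmaF s : 0 <= s <= T -> <<s F s>> = F s.
Proof. by move=> sT; apply: sigma_algebra_id; have [] := filtration_sigma normalF sT. Qed.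

Lemma adapted_event s Z (B : set R) : 0 <= s <= T -> adapted s Z -> measurable B ->
  F s (Z @^-1` B).
Proof.
move=> sT aZ mB; rewrite -[F s](sigmaF sT).
by have := aZ measurableT B mB; rewrite setTI.
Qed.

Lemma adaptedP s Z : 0 <= s <= T ->
  (forall B : set R, measurable B -> F s (Z @^-1` B)) -> adapted s Z.
Proof. by move=> sT ZB _ B mB; rewrite setTI; apply: sub_sigma_algebra; exact: ZB. Qed.

Lemma adapted_measurable s Z : 0 <= s <= T -> adapted s Z -> measurable_fun setT Z.
Proof.
move=> sT aZ _ B mB; rewrite setTI.
have [_ Fm] := filtration_sigma normalF sT.
by apply: Fm; exact: adapted_event.
Qed.

Lemma adapted_mono s t Z : 0 <= s -> s <= t -> t <= T -> adapted s Z -> adapted t Z.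
Proof.
move=> s0 st tT aZ; apply: adaptedP => [|B mB]; first by rewrite (le_trans s0 st).
by apply: (filtration_mono normalF s0 st tT); apply: adapted_event; rewrite ?s0 ?(le_trans st).
Qed.

Lemma borel_adapted s Z : 0 <= s <= T -> borel_measurable (F s) Z -> adapted s Z.
Proof. by move=> sT bZ; apply: adaptedP => // B; exact: borel_measurable_preimage. Qed.

Lemma adapted_indic s C : 0 <= s <= T -> F s C -> adapted s \1_C.
Proof.
move=> sT FC; apply: measurable_indic.
by apply: sub_sigma_algebra.
Qed.

Lemma adaptedM s Z Y : adapted s Z -> adapted s Y -> adapted s (fun x => Z x * Y x).
Proof. by move=> aZ aY; apply: measurable_funM. Qed.

Lemma adaptedB s Z Y : adapted s Z -> adapted s Y -> adapted s (fun x => Z x - Y x).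
Proof. by move=> aZ aY; apply: measurable_funB. Qed.

Lemma adapted_brownian s : 0 <= s <= T -> adapted s (W s).
Proof. by move=> sT; apply: borel_adapted => //; exact: (bm_adapted bm). Qed.

Lemma adapted_increment s t u : 0 <= s -> s <= t -> t <= u -> u <= T ->
  adapted u (fun x => W t x - W s x).
Proof.
move=> s0 st tu uT; have t0 := le_trans s0 st.
apply: adaptedB; last first.
  apply: (adapted_mono (s := s)) => //; first exact: le_trans tu.
  by apply: adapted_brownian; rewrite s0 (le_trans st)// (le_trans tu).
apply: (adapted_mono (s := t)) => //.
by apply: adapted_brownian; rewrite t0 (le_trans tu).
Qed.

Let measurable_increment s t : 0 <= s -> s <= t -> t <= T ->
  measurable_fun setT (fun x => W t x - W s x).
Proof.
move=> s0 st tT; apply: (@adapted_measurable t); first by rewrite tT (le_trans s0).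
exact: adapted_increment.
Qed.

Let increment_law s t : 0 <= s -> s < t -> t <= T -> forall U : set R, measurable U ->
  P ((fun x => W t x - W s x) @^-1` U) = normal_prob 0 (Num.sqrt (t - s)) U.
Proof. by move=> s0 st tT U mU; exact: (bm_increment bm). Qed.

Lemma increment_mean s t : 0 <= s -> s <= t -> t <= T ->
  has_mean P setT (fun x => W t x - W s x) 0.
Proof.
move=> s0; rewrite le_eqVlt => /predU1P[<-|st] tT.
  by apply: eq_has_mean (has_mean0 _ _) => x; rewrite subrr.
have sq0 : 0 < Num.sqrt (t - s) by rewrite sqrtr_gt0 subr_gt0.
have mI := measurable_increment s0 (ltW st) tT.
split; first exact: (normal_integrable mI sq0 (increment_law s0 st tT)).
exact: (normal_mean0 mI sq0 (increment_law s0 st tT)).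
Qed.

Lemma increment_sqr_mean s t : 0 <= s -> s <= t -> t <= T ->
  has_mean P setT (fun x => (W t x - W s x) ^+ 2) (t - s).
Proof.
move=> s0; rewrite le_eqVlt => /predU1P[<-|st] tT.
  by rewrite subrr; apply: eq_has_mean (has_mean0 _ _) => x; rewrite subrr expr0n.
have sq0 : 0 < Num.sqrt (t - s) by rewrite sqrtr_gt0 subr_gt0.
have mI := measurable_increment s0 (ltW st) tT.
have E := normal_second_moment mI sq0 (increment_law s0 st tT).
rewrite sqr_sqrtr ?subr_ge0 ?(ltW st)// in E.
split => //; apply/integrableP; split.
  by apply/measurable_EFinP; exact: measurable_funX.
under eq_integral do rewrite /= ger0_norm ?sqr_ge0//.
by rewrite E ltry.
Qed.

Lemma has_mean_indep s t Z c (h : R -> R) e : 0 <= s -> s <= t -> t <= T ->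
  adapted s Z -> has_mean P setT Z c -> measurable_fun setT h ->
  has_mean P setT (fun x => h (W t x - W s x)) e ->
  has_mean P setT (fun x => Z x * h (W t x - W s x)) (c * e).
Proof.
move=> s0 st tT aZ [iZ cZ] mh [ih ch].
have sT : 0 <= s <= T by rewrite s0 (le_trans st).
have mZ := adapted_measurable sT aZ.
have mI := measurable_increment s0 st tT.
have mY : measurable_fun setT (fun x => h (W t x - W s x)) by exact: (measurableT_comp mh).
pose Y := fun x => h (W t x - W s x).
have indep (A B : set R) : measurable A -> measurable B ->
    P (Z @^-1` A `&` Y @^-1` B) = (P (Z @^-1` A) * P (Y @^-1` B))%E.
  move=> mA mB; move: (st); rewrite le_eqVlt => /predU1P[ste|st'].
    (* The Brownian axioms concern s < t only. For s = t the increment is 0, and a constant is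
       independent of everything. *)
    have Y0 x : Y x = h 0 by rewrite /Y -ste subrr.
    have [hB|hB] := pselect (B (h 0)).
      rewrite (_ : Y @^-1` B = setT); last by apply/seteqP; split => // x _; rewrite /= Y0.
      by rewrite setIT probability_setT mule1.
    rewrite (_ : Y @^-1` B = set0); last by apply/seteqP; split => // x; rewrite /= Y0.
    by rewrite setI0 measure0 mule0.
  apply: (bm_independent bm s0 st' tT (U := h @^-1` B)).
    exact: adapted_event.
  by rewrite -[X in measurable X]setTI; exact: mh.
split; first exact: indep_integrableM.
by rewrite (indep_integralM mZ mY indep)// cZ ch EFinM.
Qed.

Lemma has_mean_indic s C : 0 <= s <= T -> F s C ->
  has_mean P setT \1_C (fine (P C)).
Proof.
move=> sT FC; have [_ Fm] := filtration_sigma normalF sT.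
have mC : measurable C by exact: Fm.
split; first exact: integrable_indic.
by rewrite integral_indic// setIT fineK// fin_num_measure.
Qed.

Lemma event_mono s t C : 0 <= s -> s <= t -> t <= T -> F s C -> F t C.
Proof. by move=> s0 st tT; exact: (filtration_mono normalF s0 st tT). Qed.

Lemma eventI s A B : 0 <= s <= T -> F s A -> F s B -> F s (A `&` B).
Proof.
move=> sT FA FB; rewrite -[F s](sigmaF sT).
by apply: (@measurableI _ (g_sigma_algebraType (F s))); exact: sub_sigma_algebra.
Qed.

Lemma has_mean_indep_increment s t Z c : 0 <= s -> s <= t -> t <= T ->
  adapted s Z -> has_mean P setT Z c ->
  has_mean P setT (fun x => Z x * (W t x - W s x)) 0.
Proof.
move=> s0 st tT aZ Zc; rewrite -[0](mulr0 c).
by apply: (has_mean_indep (h := id)) => //; exact: increment_mean.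
Qed.

(** The second factor is the length of the overlap of the two time intervals. By symmetry a1 <= a2;
    if the intervals do not overlap, the later increment is independent of everything else and has
    mean 0. *)
Lemma increment_pair_mean a1 b1 a2 b2 C1 C2 : 0 <= a1 -> a1 <= b1 -> b1 <= T ->
  0 <= a2 -> a2 <= b2 -> b2 <= T -> F a1 C1 -> F a2 C2 ->
  has_mean P setT
    (fun x => \1_C1 x * \1_C2 x * ((W b1 x - W a1 x) * (W b2 x - W a2 x)))
    (fine (P (C1 `&` C2)) * Num.max 0 (Num.min b1 b2 - Num.max a1 a2)).
Proof.
wlog a12 : a1 b1 a2 b2 C1 C2 / a1 <= a2 => [hw a10 ab1 b1T a20 ab2 b2T FC1 FC2|].
  have /orP[a12|a21] := le_total a1 a2.
    exact: (hw _ _ _ _ _ _ a12 a10 ab1 b1T a20 ab2 b2T FC1 FC2).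
  rewrite setIC (minC b1) (maxC a1).
  apply: eq_has_mean (hw _ _ _ _ _ _ a21 a20 ab2 b2T a10 ab1 b1T FC2 FC1).
  by move=> x; rewrite (mulrC (\1_C2 x)) (mulrC (W b2 x - _)).
move=> a10 ab1 b1T a20 ab2 b2T FC1 FC2.
have a2T : 0 <= a2 <= T by rewrite a20 (le_trans ab2).
have FC : F a2 (C1 `&` C2).
  by apply: eventI => //; apply: event_mono FC1 => //; rewrite (le_trans ab2).
have mC : measurable (C1 `&` C2) by have [_ Fm] := filtration_sigma normalF a2T; exact: Fm.
rewrite (max_r a12).
pose Z0 : Omega -> R := \1_(C1 `&` C2).
have aZ0 : adapted a2 Z0 by exact: adapted_indic.
have Z0E x : \1_C1 x * \1_C2 x = Z0 x by rewrite /Z0 indicI.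
have [b1a2|a2b1] := leP b1 a2.
  rewrite max_l ?mulr0; last first.
    by rewrite subr_le0 ge_min b1a2.
  have [c Zc] := has_mean_indicM mC (increment_mean a10 ab1 b1T).1.
  have aZ : adapted a2 (fun x => Z0 x * (W b1 x - W a1 x)).
    by apply: adaptedM => //; apply: adapted_increment => //; rewrite (le_trans ab2).
  apply: eq_has_mean (has_mean_indep_increment a20 ab2 b2T aZ Zc) => x.
  by rewrite Z0E mulrA.
(* Cutting at a2, m and M writes the product as (W a2 - W a1)(W b2 - W a2) + (W m - W a2)^2 + (W m -
   W a2)(W M - W m). In the outer terms the last increment is independent of what precedes it, so
   only the square contributes, namely m - a2. *)
pose m := Num.min b1 b2; pose M := Num.max b1 b2.
have a2m : a2 <= m by rewrite le_min (ltW a2b1).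
have mM : m <= M by rewrite /m /M ge_min le_max lexx.
have MT : M <= T by rewrite ge_max b1T.
have mT := le_trans mM MT.
have m0 := le_trans a20 a2m.
rewrite max_r ?subr_ge0//.
have [c Zc] := has_mean_indicM mC (increment_mean a10 a12 (le_trans ab2 b2T)).1.
have aZ : adapted a2 (fun x => Z0 x * (W a2 x - W a1 x)).
  by apply: adaptedM => //; apply: adapted_increment => //; rewrite (le_trans ab2).
have T1 := has_mean_indep_increment a20 ab2 b2T aZ Zc.
have T2 := has_mean_indep (h := fun y => y ^+ 2) a20 a2m mT aZ0 (has_mean_indic a2T FC)
  (@exprn_measurable _ _ _) (increment_sqr_mean a20 a2m mT).
have [c' Zc'] := has_mean_indicM mC (increment_mean a20 a2m mT).1.
have aZ' : adapted m (fun x => Z0 x * (W m x - W a2 x)).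
  apply: adaptedM; first exact: adapted_mono aZ0.
  exact: adapted_increment.
have T3 := has_mean_indep_increment m0 mM MT aZ' Zc'.
have := has_meanD measurableT T1 (has_meanD measurableT T2 T3).
rewrite add0r addr0; apply: eq_has_mean => x; rewrite Z0E /m /M.
by case: (leP b1 b2) => _; ring.
Qed.

End BrownianIncrements.

(** * Isometry and orthogonality for real elementary integrals *)

Section ElementaryIntegral.
Context {R : realType} {d : measure_display} {Omega : measurableType d}.
Variables (P : probability Omega R) (T : R) (F : R -> set (set Omega)).
Hypothesis normalF : normal_filtration P T F.
Variable W : R -> Omega -> R.
Hypothesis bm : brownian_motion P T F W.
Variables (t : R) (n : nat) (a b : 'I_n -> R) (C : 'I_n -> set Omega) (l : 'I_n -> R).
Hypotheses (t0 : 0 <= t) (tT : t <= T).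
Hypothesis ab : forall i, 0 <= a i /\ a i <= b i /\ b i <= t.
Hypothesis FC : forall i, F (a i) (C i).

(** One coordinate of a Hilbert-space elementary integral; [l i] stands for that coordinate of
    [el_L i 1]. *)
Definition step_integral x : R := \sum_(i < n) \1_(C i) x * ((W (b i) x - W (a i) x) * l i).

Definition step_process (s : R) x : R :=
  \sum_(i < n) (\1_(`]a i, b i]) s * \1_(C i) x) * l i.

Let ov i j := Num.max 0 (Num.min (b i) (b j) - Num.max (a i) (a j)).
Let Q := \sum_(i < n) \sum_(j < n) l i * l j * (fine (P (C i `&` C j)) * ov i j).

Let a0 i : 0 <= a i. Proof. by have [] := ab i. Qed.
Let aleb i : a i <= b i. Proof. by have [_ []] := ab i. Qed.
Let bT i : b i <= T. Proof. by have [_ [_ bt]] := ab i; exact: le_trans bt tT. Qed.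
Let aT i : 0 <= a i <= T. Proof. by rewrite a0 (le_trans (aleb i)). Qed.
Let mC i : measurable (C i).
Proof. by have [_ Fm] := filtration_sigma normalF (aT i); exact: Fm. Qed.

Let step_integral_sqr : has_mean P setT (fun x => step_integral x ^+ 2) Q.
Proof.
have := has_mean_sum measurableT (fun i => has_mean_sum measurableT (fun j =>
  has_meanZ measurableT (l i * l j) (increment_pair_mean normalF bm (a0 i) (aleb i) (bT i)
     (a0 j) (aleb j) (bT j) (FC i) (FC j)))).
apply: eq_has_mean => x; rewrite expr2 /step_integral big_distrlr/=.
by apply: eq_bigr => i _; apply: eq_bigr => j _; ring.
Qed.

(** Multiplied by the indicator of [C i], the initial variable is still known at time [a i], so the
    increment after [a i] has mean 0 against it. *)
Let cross Z : adapted F 0 Z -> P.-integrable setT (EFin \o Z) ->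
  has_mean P setT (fun x => Z x * step_integral x) 0.
Proof.
move=> aZ iZ.
have c i : has_mean P setT (fun x => l i * (\1_(C i) x * Z x * (W (b i) x - W (a i) x))) 0.
  rewrite -(mulr0 (l i)); apply: has_meanZ => //.
  have [c Zc] := has_mean_indicM (mC i) iZ.
  apply: (has_mean_indep_increment normalF bm _ _ _ _ Zc) => //.
  apply: adaptedM; first exact: adapted_indic.
  by apply: (adapted_mono normalF (s := 0)) => //; rewrite (le_trans (aleb i)).
have := has_mean_sum measurableT c; rewrite big1//.
apply: eq_has_mean => x; rewrite /step_integral big_distrr/=.
by apply: eq_bigr => i _; ring.
Qed.

Let step_process_sqr (s : R) : has_mean P setT (fun x => step_process s x ^+ 2)
  (\sum_(i < n) \sum_(j < n) l i * l j * fine (P (C i `&` C j)) *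
     (\1_(`]a i, b i]) s * \1_(`]a j, b j]) s)).
Proof.
have E i j : has_mean P setT (\1_(C i `&` C j)) (fine (P (C i `&` C j))).
  have mCC : measurable (C i `&` C j) by exact: measurableI.
  split; first exact: integrable_indic.
  by rewrite integral_indic// setIT fineK// fin_num_measure.
have := has_mean_sum measurableT (fun i => has_mean_sum measurableT (fun j =>
  has_meanZ measurableT (l i * l j * (\1_(`]a i, b i]) s * \1_(`]a j, b j]) s)) (E i j))).
rewrite (eq_bigr (fun i => \sum_(j < n) l i * l j * fine (P (C i `&` C j)) *
     (\1_(`]a i, b i]) s * \1_(`]a j, b j]) s))).
  apply: eq_has_mean => x; rewrite expr2 /step_process big_distrlr/=.
  by apply: eq_bigr => i _; apply: eq_bigr => j _; rewrite indicI/=; ring.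
by move=> i _; apply: eq_bigr => j _; ring.
Qed.

Let overlap i j : has_mean lebesgue_measure `]0, t[
  (fun s : R => \1_(`]a i, b i]) s * \1_(`]a j, b j]) s) (ov i j).
Proof.
pose c := Num.max (a i) (a j); pose e := Num.min (b i) (b j).
have E : (fun s : R => \1_(`]a i, b i]) s * \1_(`]a j, b j]) s : R) = \1_(`]c, e]).
  apply/funext => s; rewrite -[LHS]/((\1_(`]a i, b i]) \* \1_(`]a j, b j])) s).
  rewrite -indicI; congr (\1_ _ s); apply/seteqP; split => [x /= []|x /=];
    rewrite !in_itv/= gt_max le_min; last by move=> /andP[/andP[-> ->] /andP[-> ->]].
  by move=> /andP[-> ->] /andP[-> ->].
have I : (\int[lebesgue_measure]_(s in `]0%R, t[) (\1_(`]c, e]) s)%:E = (ov i j)%:E :> \bar R)%E.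
  (* The null endpoint t is added to the domain, since an interval ]a i, b i] may end at t. *)
  rewrite -(@integral_itv_bndoo _ 0 t _ false false); last first.
    by apply/measurable_EFinP/measurable_indic.
  rewrite integral_indic// (_ : _ `&` _ = `]c, e]%classic); last first.
    apply/seteqP; split => [x []//|x /=]; rewrite !in_itv/= => /andP[cx xe]; split.
      by rewrite cx xe.
    rewrite (le_lt_trans _ cx) ?le_max ?a0//=.
    by rewrite (le_trans xe)// ge_min; have [_ [_ ->]] := ab i.
  have := lebesgue_measure_itv `]c, e]; rewrite /= lte_fin => ce; apply: (etrans ce) => {ce}.
  rewrite /ov -/c -/e; case: ltP => ce.
    by rewrite -EFinB max_r// subr_ge0 ltW.
  by rewrite max_l// subr_le0.
rewrite E; split => //; apply/integrableP; split.
  by apply/measurable_EFinP/measurable_indic.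
under eq_integral do rewrite /= ger0_norm//.
by rewrite I ltry.
Qed.

Lemma step_isometry :
  (\int[lebesgue_measure]_(s in `]0%R, t[) \int[P]_x (step_process s x ^+ 2)%:E =
   \int[P]_x (step_integral x ^+ 2)%:E)%E.
Proof.
rewrite step_integral_sqr.2.
under eq_integral do rewrite (step_process_sqr _).2.
have mI : measurable (`]0, t[%classic : set (measurableTypeR R)) by exact: measurable_itv.
have := has_mean_sum mI (fun i => has_mean_sum mI
  (fun j => has_meanZ mI (l i * l j * fine (P (C i `&` C j))) (overlap i j))).
move=> [_ ->]; congr EFin.
by apply: eq_bigr => i _; apply: eq_bigr => j _; rewrite mulrA.
Qed.

Lemma step_process_measurable s : measurable_fun setT (step_process s).
Proof.
by apply: measurable_sum => i; apply: measurable_funM => //; apply: measurable_funM.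
Qed.

Lemma step_process_sqr_measurable :
  measurable_fun `]0, t[ (fun s : R => \int[P]_x (step_process s x ^+ 2)%:E)%E.
Proof.
rewrite (_ : (fun s => _) = (fun s => (\sum_(i < n) \sum_(j < n) l i * l j *
    fine (P (C i `&` C j)) * (\1_(`]a i, b i]) s * \1_(`]a j, b j]) s))%:E)); last first.
  by apply/funext => s; exact: (step_process_sqr s).2.
apply/measurable_EFinP; apply: measurable_sum => i; apply: measurable_sum => j.
by apply: measurable_funM => //; apply: measurable_funM => //; exact: measurable_indic.
Qed.

Lemma step_pythagoras Z : adapted F 0 Z -> (\int[P]_x (Z x ^+ 2)%:E < +oo)%E ->
  (\int[P]_x ((Z x + step_integral x) ^+ 2)%:E =
   \int[P]_x (Z x ^+ 2)%:E + \int[P]_x (step_integral x ^+ 2)%:E)%E.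
Proof.
move=> aZ Z2.
have z0T : 0 <= (0 : R) <= T by rewrite lexx (le_trans t0).
have mZ := adapted_measurable normalF z0T aZ.
have iZ := sqr_integrable mZ Z2.
have iZ2 : P.-integrable setT (EFin \o (fun x => Z x ^+ 2)).
  by have := integrable_mul_sqr mZ mZ Z2 Z2.
have [z [_ Zz]] := integrable_has_mean iZ2.
have := has_meanD measurableT (conj iZ2 Zz)
  (has_meanD measurableT (has_meanZ measurableT 2 (cross aZ iZ)) step_integral_sqr).
rewrite mulr0 add0r step_integral_sqr.2 Zz -EFinD => -[_ <-].
by apply: eq_integral => x _; congr EFin; ring.
Qed.

End ElementaryIntegral.

(** * Passing to the limit from elementary integrands *)

Section Young.
Context {R : realType}.
Local Open Scope ring_scope.

Lemma sqr_young (e x y : R) : 0 < e ->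
  x ^+ 2 <= (1 + e) * y ^+ 2 + (1 + e^-1) * (y - x) ^+ 2.
Proof.
move=> e0; rewrite -subr_ge0.
have -> : (1 + e) * y ^+ 2 + (1 + e^-1) * (y - x) ^+ 2 - x ^+ 2 =
   e^-1 * (e * y + (y - x)) ^+ 2 by field; rewrite gt_eqF.
by rewrite mulr_ge0 ?sqr_ge0// invr_ge0 ltW.
Qed.

Lemma young_limit (x M : \bar R) (A D : nat -> \bar R) :
  (0 <= M)%E -> (forall n, 0 <= A n)%E -> (forall n, 0 <= D n)%E ->
  A n @[n --> \oo] --> 0%E -> D n @[n --> \oo] --> 0%E ->
  (forall (e : R) n, (0 < e)%R -> x <= (1 + e)%:E * ((1 + e)%:E * M + (1 + e^-1)%:E * D n) +
     (1 + e^-1)%:E * A n)%E -> (x <= M)%E.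
Proof.
move=> M0 A0 D0 /fine_cvgP[Afin Acv] /fine_cvgP[Dfin Dcv] xM.
case: M M0 xM => [m| |//] m0 xM; last by rewrite leey.
rewrite lee_fin in m0; apply/lee_addgt0Pr => del del0.
have m1 : 0 < 6 * (m + 1) by rewrite mulr_gt0// ltr_wpDl.
(* As e <= 1, (1 + e)^2 m exceeds m by at most 3 e m, hence by at most del / 2. The choice of [h]
   below then leaves del / 6 for the [A] term and, since 1 + e <= 2, del / 3 for the [D] term. *)
pose e := Num.min 1 (del / (6 * (m + 1))).
have e0 : 0 < e by rewrite lt_min ltr01 divr_gt0.
have e1 : e <= 1 by rewrite ge_min lexx.
have ed : e * (6 * (m + 1)) <= del by rewrite -ler_pdivlMr// ge_min lexx orbT.
have k0 : 0 < 1 + e^-1 by rewrite ltr_wpDr ?ltr01// invr_ge0 ltW.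
pose h := del / (6 * (1 + e^-1)).
have h0 : 0 < h by rewrite divr_gt0// mulr_gt0.
have kh : 6 * ((1 + e^-1) * h) = del by rewrite mulrA /h mulrC divfK// gt_eqF// mulr_gt0.
have [n [[An Ah] [Dn Dh]]] : exists n, (A n \is a fin_num /\ fine (A n) < h) /\
    (D n \is a fin_num /\ fine (D n) < h).
  have [n] : exists n, ((A n \is a fin_num) && (fine (A n) < h)) &&
      ((D n \is a fin_num) && (fine (D n) < h)).
    near \oo => n; exists n; apply/andP; split; apply/andP; split.
    - by near: n.
    - by near: n; apply: (cvgr_lt 0).
    - by near: n.
    - by near: n; apply: (cvgr_lt 0).
  by move=> /andP[/andP[? ?] /andP[? ?]]; exists n.
apply: (le_trans (xM e n e0)).
rewrite -(fineK An) -(fineK Dn) -!(EFinM, EFinD) lee_fin.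
have h1 : (1 + e^-1) * fine (D n) <= (1 + e^-1) * h by rewrite ler_pM2l// ltW.
have h2 : (1 + e^-1) * fine (A n) <= (1 + e^-1) * h by rewrite ler_pM2l// ltW.
by nra.
Unshelve. all: by end_near. Qed.

End Young.

Section StepLowerBound.
Context {R : realType} {d : measure_display} {Omega : measurableType d}.
Variables (P : probability Omega R) (T : R) (F : R -> set (set Omega)).
Hypothesis normalF : normal_filtration P T F.
Variable W : R -> Omega -> R.
Hypothesis bm : brownian_motion P T F W.
Variables (t : R) (n : nat) (a b : 'I_n -> R) (C : 'I_n -> set Omega) (l : 'I_n -> R).
Hypotheses (t0 : 0 <= t) (tT : t <= T).
Hypothesis ab : forall i, 0 <= a i /\ a i <= b i /\ b i <= t.
Hypothesis FC : forall i, F (a i) (C i).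
Variables (Z I : Omega -> R) (Phi : R -> Omega -> R).
Hypotheses (aZ : adapted F 0 Z) (Z2 : (\int[P]_x (Z x ^+ 2)%:E < +oo)%E).
Hypothesis mI : measurable_fun setT I.
Local Notation J := (step_integral W a b C l).
Local Notation phi := (step_process a b C l).

(** Young's inequality is spent twice: to replace [Phi] by the step process in the time integral,
    and [Z + J] by [Z + I] in the expectation. Between these, isometry and Pythagoras for the step
    process are exact. *)
Lemma step_lower_bound (e : R) : 0 < e ->
  (\int[P]_x (Z x ^+ 2)%:E +
     \int[lebesgue_measure]_(s in `]0%R, t[) \int[P]_x (Phi s x ^+ 2)%:E <=
   (1 + e)%:E * ((1 + e)%:E * \int[P]_x ((Z x + I x) ^+ 2)%:E +
      (1 + e^-1)%:E * \int[P]_x ((J x - I x) ^+ 2)%:E) +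
   (1 + e^-1)%:E * \int[lebesgue_measure]_(s in `]0%R, t[)
      \int[P]_x ((phi s x - Phi s x) ^+ 2)%:E)%E.
Proof.
move=> e0.
have k0 : 0 < 1 + e by rewrite ltr_wpDr ?ltr01// ltW.
have k'0 : 0 < 1 + e^-1 by rewrite ltr_wpDr ?ltr01// invr_ge0 ltW.
have mZ : measurable_fun setT Z.
  by apply: (adapted_measurable normalF (s := 0) _ aZ); rewrite lexx (le_trans t0).
have sq0 (f : Omega -> R) x : (0 <= (f x ^+ 2)%:E :> \bar R)%E by rewrite lee_fin sqr_ge0.
have isq0 (f : Omega -> R) : (0 <= \int[P]_x (f x ^+ 2)%:E)%E by exact: integral_ge0.
have Phis s : (\int[P]_x (Phi s x ^+ 2)%:E <= (1 + e)%:E * \int[P]_x (phi s x ^+ 2)%:E +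
    (1 + e^-1)%:E * \int[P]_x ((phi s x - Phi s x) ^+ 2)%:E)%E.
  apply: lower_integral_combination => //.
  - apply/measurable_EFinP; apply: measurable_funX.
    exact: (step_process_measurable normalF l tT ab FC).
  - by move=> x _; rewrite lee_fin sqr_ge0.
  - by move=> x _; rewrite -!(EFinM, EFinD) lee_fin; exact: sqr_young.
have Phi2 := @lower_integral_combination _ _ R lebesgue_measure `]0, t[%classic
  (fun s => \int[P]_x (Phi s x ^+ 2)%:E)%E
  (fun s => \int[P]_x (phi s x ^+ 2)%:E)%E
  (fun s => \int[P]_x ((phi s x - Phi s x) ^+ 2)%:E)%E (1 + e) (1 + e^-1)
  (measurable_itv _) k0 k'0 (step_process_sqr_measurable normalF l tT ab FC)
  (fun s _ => isq0 _) (fun s _ => isq0 _) (fun s _ => isq0 _) (fun s _ => Phis s).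
have ZJ : (\int[P]_x ((Z x + J x) ^+ 2)%:E <= (1 + e)%:E * \int[P]_x ((Z x + I x) ^+ 2)%:E +
    (1 + e^-1)%:E * \int[P]_x ((J x - I x) ^+ 2)%:E)%E.
  apply: lower_integral_combination => //.
  - apply/measurable_EFinP; apply: measurable_funX; exact: measurable_funD.
  - by move=> x _; rewrite lee_fin sqr_ge0.
  - by move=> x _; rewrite lee_fin sqr_ge0.
  - by move=> x _; rewrite lee_fin sqr_ge0.
  - move=> x _; rewrite -!(EFinM, EFinD) lee_fin.
    have := sqr_young (Z x + J x) (Z x + I x) e0.
    by rewrite (_ : Z x + I x - (Z x + J x) = - (J x - I x)) ?sqrrN//; ring.
rewrite (step_isometry normalF bm l tT ab FC) in Phi2.
apply: (le_trans (leeD2l _ Phi2)).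
rewrite addeA leeD2r//; apply: le_trans (lee_wpmul2l _ ZJ); last by rewrite lee_fin ltW.
rewrite (step_pythagoras normalF bm l t0 tT ab FC aZ Z2).
rewrite (ge0_muleDr _ (isq0 Z) (isq0 (step_integral W a b C l))); apply: leeD2r.
by rewrite -[leLHS]mul1e lee_wpmul2r// lee_fin lerDl ltW.
Qed.

End StepLowerBound.

(** * The stochastic evolution equation *)

(** The constant 2^n, from iterating |x + y|^2 <= 2 |x|^2 + 2 |y|^2, is crude, but the bound serves
    only to prove finiteness. *)
Lemma sqr_norm_sum_le (R : realType) n (V : normedModType R) (v : 'I_n -> V) :
  `|\sum_(i < n) v i| ^+ 2 <= 2 ^+ n * \sum_(i < n) `|v i| ^+ 2.
Proof.
elim: n v => [|n ih] v; first by rewrite !big_ord0 normr0 expr0n mulr0.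
rewrite !big_ord_recr/=; set x := \sum_(i < n) v _; set y := v _.
have := ih (fun i => v (widen_ord (leqnSn n) i)); rewrite -/x.
set S := \sum_(i < n) `|_| ^+ 2 => xS.
have S0 : 0 <= S by apply: sumr_ge0 => i _; exact: sqr_ge0.
have n1 : 1 <= 2 ^+ n :> R by apply: exprn_ege1; rewrite ler1n.
have xy : `|x + y| ^+ 2 <= (`|x| + `|y|) ^+ 2.
  by rewrite ler_pXn2r ?nnegrE ?addr_ge0// ler_normD.
rewrite [2 ^+ _]exprS; move: xS xy n1; set p := 2 ^+ n; set X := `|x|; set Y := `|y|.
have := sqr_ge0 (X - Y); have := sqr_ge0 Y.
by nra.
Qed.

(** * Coordinates of the stochastic integral *)

Section ItoCoordinates.
Context {R : realType} {H : completeNormedModType R} {ip : {dot H for idfun}}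
  {BB : set H} {lam : H -> R} {eta kappa : R}.
Hypothesis hip : hilbert_dot ip.
Hypothesis onb : orthonormal_basis ip BB.
Hypothesis kappa_gt0 : 0 < kappa.
Hypothesis gap : forall b, BB b -> kappa <= eta + lam b.
Variable K : interpolation_spaces ip BB lam eta.
Context {d : measure_display} {Omega : measurableType d}.
Variables (P : probability Omega R) (T : R) (F : R -> set (set Omega)).
Hypothesis normalF : normal_filtration P T F.
Variable W : R -> Omega -> R.
Hypothesis bm : brownian_motion P T F W.
Variables (t : R) (q : R).
Hypotheses (t0 : 0 <= t) (tT : t <= T).

Let sum := coef_bigsum hip onb kappa_gt0 gap.
Let scale := coef_scale hip onb kappa_gt0 gap.
Let sub := coef_sub hip onb kappa_gt0 gap.

Lemma in_scale_el_integral (phi : elementary K F q t) om : in_scale (el_integral W phi om).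
Proof. by apply: in_scale_sum => i; apply: in_scaleZ; exact: HS_in_scale (el_HS i). Qed.

Lemma in_scale_el_process (phi : elementary K F q t) s om u :
  in_scale (el_process phi s om u).
Proof. by apply: in_scale_sum => i; apply: in_scaleZ; exact: HS_in_scale (el_HS i). Qed.

Lemma coef_el_integral (phi : elementary K F q t) b om : BB b ->
  coef b (el_integral W phi om) = step_integral W (el_a (e := phi)) (el_b (e := phi))
    (el_C (e := phi)) (fun i : 'I_(el_size phi) => coef b (el_L i 1)) om.
Proof.
move=> Bb; have sL (i : 'I_(el_size phi)) u : in_scale (el_L i u) by exact: HS_in_scale (el_HS i).
rewrite sum// => [|i]; last exact: in_scaleZ.
apply: eq_bigr => i _; rewrite scale//; congr (_ * _).
by rewrite (HS_linear _ (el_HS i)) scale.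
Qed.

Lemma coef_el_process (phi : elementary K F q t) b s om : BB b ->
  coef b (el_process phi s om 1) = step_process (el_a (e := phi)) (el_b (e := phi))
    (el_C (e := phi)) (fun i : 'I_(el_size phi) => coef b (el_L i 1)) s om.
Proof.
move=> Bb; have sL (i : 'I_(el_size phi)) u : in_scale (el_L i u) by exact: HS_in_scale (el_HS i).
rewrite sum// => [|i]; last exact: in_scaleZ.
by apply: eq_bigr => i _; rewrite scale.
Qed.

Variables (Phi : R -> Omega -> R -> ambient K) (I : Omega -> isp K q).
Hypothesis ito : ito_integral P T F W t Phi I.

Lemma ito_coef_measurable b : measurable_fun setT (fun om => isp_coef b (I om)).
Proof.
have [_ _ mI _] := ito; apply: borel_measurable_fun.
apply: (borel_measurable_comp (g := @isp_coef _ _ _ _ _ _ K q b)) => //.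
exact: isp_coef_continuous.
Qed.

(** A squared coordinate is at most m_b^(-2q) times the squared H_q-norm, so both approximation
    errors in the definition of the integral tend to 0 in coordinate b as well, and [young_limit]
    applies. *)
Lemma ito_coef_lower_bound b (Z : Omega -> R) : BB b -> adapted F 0 Z ->
  (\int[P]_om (Z om ^+ 2)%:E < +oo)%E ->
  (\int[P]_om (Z om ^+ 2)%:E +
     \int[lebesgue_measure]_(s in `]0%R, t[) \int[P]_om (coef b (Phi s om 1%R) ^+ 2)%:E <=
   \int[P]_om ((Z om + isp_coef b (I om)) ^+ 2)%:E)%E.
Proof.
move=> Bb aZ Z2; have [HSPhi _ _ [phi [A0 D0]]] := ito.
have sq0 (f : Omega -> R) : (0 <= \int[P]_om (f om ^+ 2)%:E)%E.
  by apply: integral_ge0 => om _; rewrite lee_fin sqr_ge0.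
have c0 : 0 <= ((eta + lam b) `^ q) ^- 2 by rewrite invr_ge0 sqr_ge0.
set c := (_ ^- 2) in c0.
have c0' : 0 < c.
  by rewrite /c invr_gt0 lt_neqAle eq_sym sqrf_eq0 (eigen_powR_neq0 kappa_gt0 gap)// sqr_ge0.
have lim0 (u : nat -> \bar R) : u n @[n --> \oo] --> 0%E ->
    (c%:E * u n @[n --> \oo] --> 0)%E.
  by move=> u0; rewrite -[0%E](mule0 c%:E); apply: cvgeZl.
apply: (young_limit (sq0 _) _ _ (lim0 _ A0) (lim0 _ D0)) => [n|n|e n e0].
- rewrite mule_ge0 ?lee_fin//; apply: integral_ge0 => s _; apply: integral_ge0 => om _.
  by rewrite HSnorm2E sqre_ge0.
- by rewrite mule_ge0 ?lee_fin//; apply: integral_ge0 => om _; rewrite sqre_ge0.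
have k'0 : 0 <= 1 + e^-1 by rewrite addr_ge0// invr_ge0 ltW.
have k0 : 0 <= 1 + e by rewrite addr_ge0// ltW.
have tphi (i : 'I_(el_size (phi n))) := el_time i.
have Fphi (i : 'I_(el_size (phi n))) := el_event i.
apply: (le_trans (step_lower_bound normalF bm
  (fun i : 'I_(el_size (phi n)) => coef b (el_L i 1)) t0 tT tphi Fphi
  (fun s om => coef b (Phi s om 1)) aZ Z2 (ito_coef_measurable b) e0)).
apply: leeD; apply: lee_wpmul2l; rewrite ?lee_fin//.
  apply: leeD2l; apply: lee_wpmul2l; rewrite ?lee_fin//.
  apply: (le_trans _ (le_lower_integralZl P c0' _)) => [|om _]; last exact: sqre_ge0.
  apply: le_lower_integral => om _; first by rewrite lee_fin sqr_ge0.
  rewrite -coef_el_integral// -(coef_inclq hip onb kappa_gt0 gap)// -sub//.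
  - apply: (coef_sqr_le hip onb kappa_gt0 gap) => //; apply: in_scaleB.
      exact: in_scale_el_integral.
    exact: in_scale_inclq.
  - exact: in_scale_el_integral.
  - exact: in_scale_inclq.
pose gap2 (s : R) om := HSnorm2 q (fun u => el_process (phi n) s om u - Phi s om u).
have gap20 s om : (0 <= gap2 s om)%E by rewrite /gap2 HSnorm2E sqre_ge0.
apply: (le_trans _ (le_lower_integralZl _ c0' _)) => [|s _]; last first.
  by apply: integral_ge0 => om _; exact: gap20.
apply: le_lower_integral => s; rewrite /= in_itv/= => s0t; first exact: sq0.
apply: (le_trans _ (le_lower_integralZl _ c0' _)) => [|om _]; last exact: gap20.
apply: le_lower_integral => om _; first by rewrite lee_fin sqr_ge0.
rewrite /gap2 HSnorm2E -coef_el_process// -sub//.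
- apply: (coef_sqr_le hip onb kappa_gt0 gap) => //; apply: in_scaleB.
    exact: in_scale_el_process.
  exact: HS_in_scale (HSPhi _ _ s0t).
- exact: in_scale_el_process.
- exact: HS_in_scale (HSPhi _ _ s0t).
Qed.

(** Some approximating elementary integral is at finite mean-square distance from [I], and it has
    itself a finite second moment. *)
Lemma ito_sqr_integrable : (\int[P]_om (`|I om| ^+ 2)%:E < +oo)%E.
Proof.
have [_ _ mI [phi [_ D0]]] := ito.
have [n Dn] : exists n, (\int[P]_om
    (qnorm q (el_integral W (phi n) om - inclq K q (I om))%R ^+ 2) < +oo)%E.
  have /fine_cvgP[fin _] := D0; have [n nfin] := filter_ex fin.
  by exists n; rewrite ltey_eq nfin.
pose l (i : 'I_(el_size (phi n))) : isp K q :=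
  xget 0 [set y | inclq K q y = el_L i 1].
have lE i : inclq K q (l i) = el_L i 1.
  by rewrite /l; case: xgetP => // nl; have [y _ /nl] := HS_range (el_HS i).
pose y om := \sum_(i < el_size (phi n)) (\1_(el_C i) om * (W (el_b i) om - W (el_a i) om)) *: l i.
have yE om : inclq K q (y om) = el_integral W (phi n) om.
  rewrite linear_sum; apply: eq_bigr => i _.
  by rewrite linearZ/= lE -scalerA -(HS_linear _ (el_HS i)).
(* A real measurable majorant of |y|^2 with explicit mean; it stands in for the norm of the
   vector-valued [y], whose measurability would need a separate argument. *)
pose g om := 2 ^+ el_size (phi n) *
   \sum_(i < el_size (phi n)) `|l i| ^+ 2 * (W (el_b i) om - W (el_a i) om) ^+ 2.
have [gi gE] : has_mean P setT g (2 ^+ el_size (phi n) *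
   \sum_(i < el_size (phi n)) `|l i| ^+ 2 * (el_b i - el_a i)).
  apply: has_meanZ => //; apply: has_mean_sum => // i; apply: has_meanZ => //.
  have [? [? ?]] := el_time i.
  apply: (increment_sqr_mean normalF bm) => //; exact: le_trans tT.
have yg om : `|y om| ^+ 2 <= g om.
  apply: (le_trans (sqr_norm_sum_le _)); rewrite ler_wpM2l ?exprn_ge0//.
  apply: ler_sum => i _; rewrite normrZ exprMn mulrC ler_wpM2l ?sqr_ge0//.
  rewrite normrM exprMn real_normK ?num_real// -[leRHS]mul1r real_normK ?num_real//.
  by rewrite ler_wpM2r ?sqr_ge0// indicE; case: (_ \in _); rewrite ?expr1n ?expr0n.
have h : (\int[P]_om (`|I om| ^+ 2)%:E <= 2%:E * \int[P]_om (g om)%:E + 2%:E *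
  \int[P]_om (qnorm q (el_integral W (phi n) om - inclq K q (I om))%R ^+ 2))%E.
  apply: lower_integral_combination => //.
  - exact: (measurable_int _ gi).
  - by move=> om _; rewrite lee_fin (le_trans _ (yg om))// sqr_ge0.
  - by move=> om _; exact: sqre_ge0.
  move=> om _; rewrite -yE -linearB qnorm_inclq -EFin_expe -!(EFinM, EFinD) lee_fin.
  have := yg om.
  have := ler_normB (y om) (y om - I om); rewrite subKr.
  have := sqr_ge0 (`|y om| - `|y om - I om|); have := normr_ge0 (I om).
  by nra.
apply: (le_lt_trans h); rewrite gE.
by rewrite lte_add_pinfty// lte_mul_pinfty// ltry.
Qed.

End ItoCoordinates.

(** Read off from the distribution function of the exponential law of rate a. *)
Lemma integral_expR (R : realType) (a t : R) : 0 < a -> 0 < t ->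
  (\int[lebesgue_measure]_(s in `]0%R, t[) (expR (- a * s))%:E)%E =
  ((1 - expR (- a * t)) / a)%:E.
Proof.
move=> a0 t0; have := exponential_prob_itv0c a t0; rewrite /exponential_prob.
have mpdf : measurable_fun (`]0, t[%classic : set (measurableTypeR R))
    (fun s => (exponential_pdf a s)%:E).
  by apply: measurable_funTS; apply/measurable_EFinP; exact: measurable_exponential_pdf.
rewrite integral_itv_bndoo// => pdfE.
transitivity (\int[lebesgue_measure]_(s in `]0%R, t[)
    ((a^-1)%:E * (exponential_pdf a s)%:E))%E.
  apply: eq_integral => s; rewrite inE/= in_itv/= => /andP[/ltW s0 _].
  by rewrite exponential_pdfE// -EFinM mulKf// gt_eqF.
rewrite ge0_integralZl ?lee_fin ?invr_ge0 ?(ltW a0)//; last first.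
  by move=> s _; rewrite lee_fin exponential_pdf_ge0// ltW.
by rewrite pdfE -EFinB -EFinM mulrC.
Qed.

Lemma Lnorm2E {d : measure_display} {T : measurableType d} {R : realType}
    (mu : {measure set T -> \bar R}) (f : T -> \bar R) : (forall x, 0 <= f x)%E ->
  Lnorm mu 2%:E f = ((\int[mu]_x (f x ^+ 2)) `^ 2^-1)%E.
Proof.
move=> f0; rewrite unlock; congr (_ `^ _)%E; apply: eq_integral => x _.
rewrite gee0_abs//; case: (f x) (f0 x) => [y||//].
  by rewrite lee_fin => y0; rewrite poweR_EFin powR_mulrn.
by rewrite poweRyr// expe2 mulyy.
Qed.

(** * Moment bounds for the mild solution *)

Section MildSolution.
Context {R : realType} {H : completeNormedModType R} {ip : {dot H for idfun}}
  {BB : set H} {lam : H -> R} {eta kappa : R}.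
Hypothesis hip : hilbert_dot ip.
Hypothesis onb : orthonormal_basis ip BB.
Hypothesis cBB : countable BB.
Hypothesis kappa_gt0 : 0 < kappa.
Hypothesis gap : forall b, BB b -> kappa <= eta + lam b.
Variable K : interpolation_spaces ip BB lam eta.
Variable expA : R -> ambient K -> ambient K.
Hypothesis semigroup_expA : extended_semigroup expA.
Context {d : measure_display} {Omega : measurableType d}.
Variables (P : probability Omega R) (T : R) (F : R -> set (set Omega)).
Hypothesis T_gt0 : 0 < T.
Hypothesis normalF : normal_filtration P T F.
Variable W : R -> Omega -> R.
Hypothesis bm : brownian_motion P T F W.
Variables (delta q : R) (w : ambient K) (xi : Omega -> isp K delta).
Hypothesis w_scale : in_scale w.
Hypothesis measurable_xi : borel_measurable (F 0) xi.
Variable B : H -> R -> ambient K.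
Hypothesis BE : forall v u, B v u = u *: (`|v| *: w).
Variable X : R -> Omega -> isp K delta.
Hypothesis X_in_H : forall t om, 0 < t <= T -> range (inclH K) (inclq K delta (X t om)).
Hypothesis initial_integrable : forall t, 0 < t <= T ->
  (\int[P]_om (qnorm q (expA t (inclq K delta (xi om))) ^+ 2) < +oo)%E.
Hypothesis mildX : forall t, 0 < t <= T -> exists I : Omega -> isp K q,
  ito_integral P T F W t
    (fun s om u => expA (t - s) (B (toH (inclq K delta (X s om))) u)) I /\
  {ae P, forall om, inclq K delta (X t om) =
                    expA t (inclq K delta (xi om)) + inclq K q (I om)}.

Local Notation m := (fun b => eta + lam b).
Local Notation e := (fun b t => expR (t * - lam b)).
Local Notation V := (fun b => \int[P]_om (isp_coef b (xi om) ^+ 2)%:E)%E.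

Let semigroup_coef := extended_semigroup_coef hip onb kappa_gt0 gap.

Lemma second_moment_ge0 b : (0 <= V b)%E.
Proof. by apply: integral_ge0 => om _; rewrite lee_fin sqr_ge0. Qed.

Lemma initial_coef_adapted b : adapted F 0 (fun om => isp_coef b (xi om)).
Proof.
apply: (borel_adapted (T := T)); first by rewrite lexx ltW.
by apply: (borel_measurable_comp (g := @isp_coef _ _ _ _ _ _ K delta b)) => //;
  exact: isp_coef_continuous.
Qed.

Lemma initial_coef_measurable b : measurable_fun setT (fun om => isp_coef b (xi om)).
Proof.
apply: (adapted_measurable normalF _ (initial_coef_adapted b)).
by rewrite lexx ltW.
Qed.

Lemma semigroup_initial_coef t b om : 0 <= t -> BB b ->
  coef b (expA t (inclq K delta (xi om))) = e b t * isp_coef b (xi om).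
Proof.
move=> t0 Bb; have [_ ->//] := semigroup_coef semigroup_expA t0 (in_scale_inclq (xi om)).
by rewrite (coef_inclq hip onb kappa_gt0 gap).
Qed.

(** Coordinate b of e^(TA) xi is square integrable because its H_q-norm is, and it is xi_b times the
    positive number e^(- lam_b T). The constant is not uniform in b, so no summability follows. *)
Lemma second_moment_lty b : BB b -> (V b < +oo)%E.
Proof.
move=> Bb; have T0 : 0 < T <= T by rewrite T_gt0 lexx.
have [T0' _] := andP T0; have {}T0' := ltW T0'.
pose k := (e b T) ^- 2 * ((eta + lam b) `^ q) ^- 2.
have k0 : 0 < k.
  rewrite mulr_gt0 ?invr_gt0 ?exprn_gt0 ?expR_gt0//.
  by rewrite lt_neqAle powR_ge0 eq_sym (eigen_powR_neq0 kappa_gt0 gap).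
apply: (@le_lt_trans _ _ (k%:E *
  \int[P]_om (qnorm q (expA T (inclq K delta (xi om))) ^+ 2))%E); last first.
  by apply: lte_mul_pinfty; rewrite ?initial_integrable// lee_fin ltW.
apply: (le_trans _ (le_lower_integralZl P k0 _)) => [|om _]; last exact: sqre_ge0.
apply: le_lower_integral => om _; first by rewrite lee_fin sqr_ge0.
have [sE _] := semigroup_coef semigroup_expA T0' (in_scale_inclq (xi om)).
rewrite [k%:E]EFinM -muleA -lee_pdivrMl ?invr_gt0 ?exprn_gt0 ?expR_gt0//.
rewrite invrK -EFinM -exprMn -semigroup_initial_coef//.
exact: (coef_sqr_le hip onb kappa_gt0 gap).
Qed.

(** One version [I] of the integral, outside a single null set, serves all coordinates at once. By
    [BE] the integrand has coordinate e^(- lam_b (t - s)) ||X_s|| w_b. *)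
Lemma mild_coef_bound t : 0 < t <= T -> exists I : Omega -> isp K q,
  [/\ {ae P, forall om, inclq K delta (X t om) =
        expA t (inclq K delta (xi om)) + inclq K q (I om)},
      (\int[P]_om (`|I om| ^+ 2)%:E < +oo)%E,
      forall b, BB b ->
        measurable_fun setT (fun om => e b t * isp_coef b (xi om) + isp_coef b (I om)) &
      forall b, BB b ->
      ((e b t ^+ 2)%:E * V b + \int[lebesgue_measure]_(s in `]0%R, t[)
         \int[P]_om ((e b (t - s) * (`|toH (inclq K delta (X s om))| * coef b w)) ^+ 2)%:E
       <= \int[P]_om ((e b t * isp_coef b (xi om) + isp_coef b (I om)) ^+ 2)%:E)%E].
Proof.
move=> tT; have [I [ito Xt]] := mildX tT; exists I.
have /andP[t0 tT'] := tT; have t0' := ltW t0.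
split=> //; first exact: (ito_sqr_integrable normalF bm tT' ito).
  move=> b Bb; apply: measurable_funD; last exact: ito_coef_measurable ito _.
  apply: measurable_funM; first exact: measurable_cst.
  exact: initial_coef_measurable.
move=> b Bb.
have mZ := initial_coef_measurable b.
have ZE : (\int[P]_om ((e b t * isp_coef b (xi om)) ^+ 2)%:E = (e b t ^+ 2)%:E * V b)%E.
  rewrite -ge0_integralZl//.
  - by apply: eq_integral => om _; rewrite exprMn EFinM.
  - by apply/measurable_EFinP; apply: measurable_funX.
  - by move=> om _; rewrite lee_fin sqr_ge0.
have := ito_coef_lower_bound hip onb kappa_gt0 gap normalF bm t0' tT' ito Bb
  (Z := fun om => e b t * isp_coef b (xi om)).
rewrite ZE => h; apply: (le_trans _ (h _ _)).
- apply: leeD2l; apply: le_lower_integral => s; rewrite /= in_itv/= => /andP[s0 st].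
    by apply: integral_ge0 => om _; rewrite lee_fin sqr_ge0.
  apply: le_lower_integral => om _; first by rewrite lee_fin sqr_ge0.
  have ts : 0 <= t - s by rewrite subr_ge0 ltW.
  rewrite BE scale1r.
  have [_ ->//] := semigroup_coef semigroup_expA ts
    (in_scaleZ `|toH (inclq K delta (X s om))| w_scale).
  by rewrite (coef_scale hip onb kappa_gt0 gap).
- apply: measurable_funM; first exact: measurable_cst.
  exact: initial_coef_adapted.
- by rewrite lte_mul_pinfty ?lee_fin ?sqr_ge0// second_moment_lty.
Qed.

Lemma measurable_esum_sqr (a : H -> R) (Y : H -> Omega -> R) :
  (forall b, BB b -> measurable_fun setT (Y b)) ->
  measurable_fun setT (fun om => \esum_(b in BB) ((a b * Y b om) ^+ 2)%:E).
Proof.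
move=> mY; apply: measurable_esum => // [b om _|b Bb].
  by rewrite lee_fin sqr_ge0.
apply/measurable_EFinP; apply: measurable_funX; apply: measurable_funM.
  exact: measurable_cst.
exact: mY.
Qed.

Lemma integral_esum_sqr (a : H -> R) (Y : H -> Omega -> R) :
  (forall b, BB b -> measurable_fun setT (Y b)) ->
  (\int[P]_om (\esum_(b in BB) ((a b * Y b om) ^+ 2)%:E) =
   \esum_(b in BB) ((a b ^+ 2)%:E * \int[P]_om (Y b om ^+ 2)%:E))%E.
Proof.
move=> mY; have mY2 b : BB b -> measurable_fun setT (fun om => (Y b om ^+ 2)%:E).
  by move=> Bb; apply/measurable_EFinP; apply: measurable_funX; exact: mY.
rewrite integral_esum// => [|b om _|b Bb]; last 2 first.
- by rewrite lee_fin sqr_ge0.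
- apply/measurable_EFinP; apply: measurable_funX; apply: measurable_funM.
    exact: measurable_cst.
  exact: mY.
apply: eq_esum => b Bb; rewrite -ge0_integralZl ?lee_fin ?sqr_ge0//; last 2 first.
- exact: mY2.
- by move=> om _; rewrite lee_fin sqr_ge0.
by apply: eq_integral => om _; rewrite exprMn EFinM.
Qed.

Lemma mild_coef t I om b : 0 <= t -> BB b ->
  inclq K delta (X t om) = expA t (inclq K delta (xi om)) + inclq K q (I om) ->
  coef b (inclq K delta (X t om)) = e b t * isp_coef b (xi om) + isp_coef b (I om).
Proof.
move=> t0 Bb ->; have [sE _] := semigroup_coef semigroup_expA t0 (in_scale_inclq (xi om)).
rewrite (coef_add hip onb kappa_gt0 gap)//; last exact: in_scale_inclq.
by rewrite semigroup_initial_coef// (coef_inclq hip onb kappa_gt0 gap).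
Qed.

(** The noise contribution is dropped and Parseval in H is applied, which is where X_s taking values
    in H enters. *)
Lemma mild_H_norm_bound s : 0 < s <= T ->
  (\esum_(c in BB) ((e c s ^+ 2)%:E * V c) <=
   \int[P]_om (`|toH (inclq K delta (X s om))| ^+ 2)%:E)%E.
Proof.
move=> sT; have [I [Xs _ mY YE]] := mild_coef_bound sT.
have s0 : 0 <= s by case/andP: sT => /ltW.
pose Y b om := e b s * isp_coef b (xi om) + isp_coef b (I om).
apply: (@le_trans _ _ (\int[P]_om (\esum_(b in BB) ((1 * Y b om) ^+ 2)%:E))%E).
  rewrite integral_esum_sqr//; apply: le_esum => b Bb; rewrite expr1n mul1e.
  apply: (le_trans _ (YE b Bb)); rewrite leeDl//.
  by apply: integral_ge0 => u _; apply: integral_ge0 => om _; rewrite lee_fin sqr_ge0.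
apply: ae_le_lower_integral.
- exact: measurable_esum_sqr.
- by move=> om; apply: esum_ge0 => b _; rewrite lee_fin sqr_ge0.
- by move=> om; rewrite lee_fin sqr_ge0.
- move: Xs; apply: filterS => om Xs.
  rewrite (toH_norm hip onb kappa_gt0 gap); last exact: X_in_H.
  by apply: le_esum => b Bb; rewrite mul1r (mild_coef s0 Bb Xs).
Qed.

(** The time integral left after the factor depending on b has been pulled out. The exponent
    contains m_c instead of lam_c because e^(2 lam_b s) has been replaced by its lower bound e^(-2
    eta s). *)
Definition weighted_moment (t : R) : \bar R :=
  (\int[lebesgue_measure]_(s in `]0%R, t[)
     \esum_(c in BB) (V c * (expR (- (2 * m c) * s))%:E))%E.

Lemma weighted_moment_ge0 t : (0 <= weighted_moment t)%E.
Proof.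
apply: integral_ge0 => s _; apply: esum_ge0 => c _.
by rewrite mule_ge0 ?second_moment_ge0// lee_fin expR_ge0.
Qed.

Lemma mild_integrand_bound t b : 0 < t <= T -> BB b ->
  (((e b t * coef b w) ^+ 2)%:E * weighted_moment t <=
   \int[lebesgue_measure]_(s in `]0%R, t[)
     \int[P]_om ((e b (t - s) * (`|toH (inclq K delta (X s om))| * coef b w)) ^+ 2)%:E)%E.
Proof.
move=> /andP[t0 tT] Bb.
apply: (le_trans (ge_lower_integralZl _ (sqr_ge0 _) _)) => [s _|].
  by apply: esum_ge0 => c _; rewrite mule_ge0 ?second_moment_ge0// lee_fin expR_ge0.
apply: le_lower_integral => s; rewrite /= in_itv/= => /andP[s0 st].
  apply: mule_ge0; first by rewrite lee_fin sqr_ge0.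
  by apply: esum_ge0 => c _; rewrite mule_ge0 ?second_moment_ge0// lee_fin expR_ge0.
have sT : 0 < s <= T by rewrite s0 (le_trans (ltW st)).
have -> : (\int[P]_om ((e b (t - s) * (`|toH (inclq K delta (X s om))| * coef b w)) ^+ 2)%:E
   = \int[P]_om (((e b (t - s) * coef b w) ^+ 2)%:E *
      (`|toH (inclq K delta (X s om))| ^+ 2)%:E))%E.
  apply: eq_integral => om _; rewrite -EFinM -exprMn; congr (_ ^+ 2)%:E.
  by rewrite mulrA mulrAC.
apply: (le_trans _ (ge_lower_integralZl _ (sqr_ge0 _) _)) => [|om _]; last first.
  by rewrite lee_fin sqr_ge0.
apply: (@le_trans _ _ (((e b (t - s) * coef b w) ^+ 2)%:E *
  \esum_(c in BB) ((e c s ^+ 2)%:E * V c))%E); last first.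
  by apply: lee_wpmul2l; rewrite ?lee_fin ?sqr_ge0// mild_H_norm_bound.
rewrite -!esumZl ?lee_fin ?sqr_ge0//; last 2 first.
- by move=> c _; rewrite mule_ge0 ?second_moment_ge0// lee_fin sqr_ge0.
- by move=> c _; rewrite mule_ge0 ?second_moment_ge0// lee_fin expR_ge0.
apply: le_esum => c Bc; rewrite [(V c * _)%E]muleC !muleA -!EFinM.
apply: lee_wpmul2r; first exact: second_moment_ge0.
rewrite lee_fin !exprMn -![_ * coef b w ^+ 2 * _]mulrAC ler_wpM2r ?sqr_ge0//.
rewrite !expr2 -!expRD ler_expR.
(* After cancellation the exponents differ by 2 s (eta + lam_b), which is nonnegative. *)
have := eigen_gt0 kappa_gt0 gap Bb; nra.
Qed.

Lemma weighted_momentE t : 0 < t -> weighted_moment t =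
  (\esum_(c in BB) (V c * ((1 - expR (- (2 * m c) * t)) / (2 * m c))%:E))%E.
Proof.
move=> t0; rewrite /weighted_moment.
have me c : measurable_fun (`]0, t[%classic : set (measurableTypeR R))
    (fun s => (expR (- (2 * m c) * s))%:E).
  by apply/measurable_EFinP; apply: measurableT_comp => //; exact: measurable_funM.
rewrite integral_esum//; last 2 first.
- by move=> c s _; rewrite mule_ge0 ?second_moment_ge0// lee_fin expR_ge0.
- by move=> c _; apply: measurable_funeM.
apply: eq_esum => c Bc; rewrite ge0_integralZl ?second_moment_ge0//.
  by rewrite integral_expR// mulr_gt0// (eigen_gt0 kappa_gt0 gap).
Qed.

Lemma initial_qnormE p om : (qnorm p (inclq K delta (xi om)) ^+ 2)%E =
  \esum_(b in BB) ((m b `^ p * isp_coef b (xi om)) ^+ 2)%:E.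
Proof.
rewrite (qnormE hip onb kappa_gt0 gap _ (in_scale_inclq (xi om))).
by apply: eq_esum => b Bb; rewrite (coef_inclq hip onb kappa_gt0 gap).
Qed.

(** The bound m_c >= kappa is used only in the exponential; the remaining 1 / m_c is the square of
    the weight m_c^(-1/2) of H_(-1/2). *)
Lemma weighted_moment_lower_bound t : 0 < t ->
  (((1 - expR (- (2 * kappa) * t)) / 2)%:E *
     \int[P]_om (qnorm (- 2^-1) (inclq K delta (xi om)) ^+ 2) <= weighted_moment t)%E.
Proof.
move=> t0; have k0 : 0 <= (1 - expR (- (2 * kappa) * t)) / 2.
  rewrite divr_ge0// subr_ge0 -expR0 ler_expR mulNr oppr_le0.
  by rewrite !mulr_ge0// ltW.
under eq_integral do rewrite initial_qnormE.
rewrite (integral_esum_sqr (fun b => m b `^ - 2^-1)) => [|b _]; last first.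
  exact: initial_coef_measurable.
rewrite weighted_momentE// -esumZl ?lee_fin//; last first.
  by move=> b _; rewrite mule_ge0 ?second_moment_ge0// lee_fin sqr_ge0.
apply: le_esum => b Bb; have mb := eigen_gt0 kappa_gt0 gap Bb.
rewrite [leRHS]muleC muleA; apply: lee_wpmul2r; first exact: second_moment_ge0.
have -> : ((eta + lam b) `^ (- 2^-1)) ^+ 2 = (eta + lam b)^-1.
  by rewrite -powR_mulrn ?powR_ge0// -powRrM mulNr mulVf// powR_inv1// ltW.
rewrite -EFinM lee_fin invfM mulrA ler_wpM2r ?invr_ge0 ?(ltW mb)//.
rewrite ler_wpM2r// lerD2l lerN2 ler_expR.
have := gap Bb; nra.
Qed.

(** At time t itself only the noise term is kept; the initial value has entered through its effect
    on X_s at the earlier times s. *)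
Lemma mild_norm_lower_bound t : 0 < t <= T ->
  (qnorm q (expA t w) ^+ 2 * weighted_moment t <=
   \int[P]_om (qnorm q (inclq K delta (X t om)) ^+ 2))%E.
Proof.
move=> tT; have [I [Xt _ mY YE]] := mild_coef_bound tT.
have t0 : 0 <= t by case/andP: tT => /ltW.
pose Y b om := e b t * isp_coef b (xi om) + isp_coef b (I om).
have [swt wt] := semigroup_coef semigroup_expA t0 w_scale.
apply: (@le_trans _ _ (\int[P]_om (\esum_(b in BB) ((m b `^ q * Y b om) ^+ 2)%:E))%E).
  rewrite (integral_esum_sqr (fun b => m b `^ q))//.
  rewrite (qnormE hip onb kappa_gt0 gap _ swt) muleC -esumZl ?weighted_moment_ge0//; last first.
    by move=> b _; rewrite lee_fin sqr_ge0.
  apply: le_esum => b Bb; rewrite wt// exprMn EFinM muleCA.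
  apply: lee_wpmul2l; first by rewrite lee_fin sqr_ge0.
  rewrite muleC; apply: (le_trans (mild_integrand_bound tT Bb)).
  apply: (le_trans _ (YE b Bb)); rewrite leeDr//.
  by rewrite mule_ge0 ?second_moment_ge0// lee_fin sqr_ge0.
apply: ae_le_lower_integral.
- exact: (measurable_esum_sqr (fun b => m b `^ q)).
- by move=> om; apply: esum_ge0 => b _; rewrite lee_fin sqr_ge0.
- by move=> om; exact: sqre_ge0.
- move: Xt; apply: filterS => om Xt.
  rewrite (qnormE hip onb kappa_gt0 gap _ (in_scale_inclq (X t om))).
  by apply: le_esum => b Bb; rewrite (mild_coef t0 Bb Xt).
Qed.

(** Coordinatewise (u + v)^2 <= 2 u^2 + 2 v^2 separates the initial part, measurable as a countable
    sum of coordinates, from the stochastic integral, whose second moment is finite. *)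
Lemma mild_norm_lty t : 0 < t <= T ->
  (\int[P]_om (qnorm q (inclq K delta (X t om)) ^+ 2) < +oo)%E.
Proof.
move=> tT; have [I [Xt I2 mY _]] := mild_coef_bound tT.
have t0 : 0 <= t by case/andP: tT => /ltW.
pose Y b om := e b t * isp_coef b (xi om) + isp_coef b (I om).
have sE om := semigroup_coef semigroup_expA t0 (in_scale_inclq (xi om)).
apply: (@le_lt_trans _ _ (\int[P]_om (\esum_(b in BB) ((m b `^ q * Y b om) ^+ 2)%:E))%E).
  apply: ae_ge_lower_integral.
  - exact: (measurable_esum_sqr (fun b => m b `^ q)).
  - by move=> om; apply: esum_ge0 => b _; rewrite lee_fin sqr_ge0.
  - by move=> om; exact: sqre_ge0.
  - move: Xt; apply: filterS => om Xt.
    rewrite (qnormE hip onb kappa_gt0 gap _ (in_scale_inclq (X t om))).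
    by apply: le_esum => b Bb; rewrite (mild_coef t0 Bb Xt).
have h : (\int[P]_om (\esum_(b in BB) ((m b `^ q * Y b om) ^+ 2)%:E) <=
   2%:E * \int[P]_om (qnorm q (expA t (inclq K delta (xi om))) ^+ 2) +
   2%:E * \int[P]_om (`|I om| ^+ 2)%:E)%E.
  apply: lower_integral_combination => //.
  - have : measurable_fun setT (fun om => \esum_(b in BB)
        ((m b `^ q * (e b t * isp_coef b (xi om))) ^+ 2)%:E).
      apply: (measurable_esum_sqr (fun b => m b `^ q) (Y := fun b om => _)) => b _.
      by apply: measurable_funM => //; exact: initial_coef_measurable.
    apply: eq_measurable_fun => om _; rewrite (qnormE hip onb kappa_gt0 gap _ (sE om).1).
    by apply: eq_esum => b Bb; rewrite semigroup_initial_coef.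
  - by move=> om _; apply: esum_ge0 => b _; rewrite lee_fin sqr_ge0.
  - by move=> om _; exact: sqre_ge0.
  - move=> om _; rewrite (qnormE hip onb kappa_gt0 gap _ (sE om).1).
    rewrite -(isp_parseval hip onb kappa_gt0 gap (I om)) -!esumZl ?lee_fin//; last 2 first.
    + by move=> b _; rewrite lee_fin sqr_ge0.
    + by move=> b _; rewrite lee_fin sqr_ge0.
    rewrite -esumD; last 2 first.
    + by move=> b _; rewrite mule_ge0 ?lee_fin ?sqr_ge0.
    + by move=> b _; rewrite mule_ge0 ?lee_fin ?sqr_ge0.
    apply: le_esum => b Bb; rewrite semigroup_initial_coef// /Y.
    rewrite -!(EFinM, EFinD) lee_fin mulrDr.
    set u := _ * (_ * _); set v := _ * isp_coef _ _.
    have := sqr_ge0 (u - v); nra.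
apply: (le_lt_trans h); rewrite lte_add_pinfty// lte_mul_pinfty//.
exact: initial_integrable.
Qed.

(** A nonnegative variable of finite mean is almost surely finite, and a finite weighted square sum
    means membership in H_(-1/2). *)
Lemma initial_in_half_scale :
  (\int[P]_om (qnorm (- 2^-1) (inclq K delta (xi om)) ^+ 2) < +oo)%E ->
  P [set om | range (inclq K (- 2^-1)) (inclq K delta (xi om))] = 1%E.
Proof.
pose f om := (qnorm (- 2^-1) (inclq K delta (xi om)) ^+ 2)%E.
have f0 om : (0 <= f om)%E by exact: sqre_ge0.
have mf : measurable_fun setT f.
  have := measurable_esum_sqr (fun b => m b `^ (- 2^-1))
    (fun b _ => initial_coef_measurable b).
  by apply: eq_measurable_fun => om _; rewrite /f initial_qnormE.
rewrite -/f => fi.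
have -> : [set om | range (inclq K (- 2^-1)) (inclq K delta (xi om))] =
    [set om | f om < +oo]%E.
  apply/seteqP; split=> om /=.
    by case=> y _ yxi; rewrite /f -yxi qnorm_inclq -EFin_expe ltry.
  rewrite /f initial_qnormE => h.
  apply: (range_inclq hip onb kappa_gt0 gap (in_scale_inclq (xi om))).
  apply: le_lt_trans h; apply: le_esum => b Bb.
  by rewrite (coef_inclq hip onb kappa_gt0 gap).
have mA : measurable [set om | f om < +oo]%E.
  by rewrite -[[set om | _]]setTI; exact: emeasurable_fun_infty_o.
rewrite -[X in P X]setCK probability_setC; last exact: measurableC.
rewrite measure_negligible ?sube0//; first exact: measurableC.
have if_ : P.-integrable setT f.
  by apply/integrableP; split=> //; under eq_integral do rewrite gee0_abs//.
have := integrable_ae measurableT if_; apply: filterS => om /(_ I).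
by rewrite ge0_fin_numE//.
Qed.

End MildSolution.

Theorem proposition3p4 (R : realType) (H : completeNormedModType R)
    (ip : {dot H for idfun}) (hilbertH : hilbert_dot ip)
    (separableH : separable H)
    (T eta delta : R) (T_gt0 : 0 < T)
    (d : measure_display) (Omega : measurableType d)
    (P : probability Omega R) (F : R -> set (set Omega))
    (normalF : normal_filtration P T F)
    (BB : set H) (lam : H -> R) (DA : set H) (A : H -> H)
    (diagA : diagonal_operator ip BB lam DA A)
    (specA : spectrum DA A `<=` [set x | x < eta])
    (K : interpolation_spaces ip BB lam eta)
    (expA : R -> ambient K -> ambient K) (semigroup_expA : extended_semigroup expA)
    (r beta : R) (r_ge0 : 0 <= r) (beta_ge0 : 0 <= beta)
    (w : isp K (- beta)) (w_neq0 : w != 0)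
    (xi : Omega -> isp K delta) (measurable_xi : borel_measurable (F 0) xi)
    (B : H -> R -> ambient K)
    (HS_B : forall v, HS (- beta) (B v))
    (continuous_B : HS_continuous (- beta) B)
    (BE : forall v u, B v u = u *: (`|v| *: inclq K (- beta) w))
    (W : R -> Omega -> R) (brownianW : brownian_motion P T F W)
    (X : R -> Omega -> isp K delta)
    (predictableX : predictable_process T F X)
    (X_in_H : forall t om, 0 < t <= T ->
      range (inclH K) (inclq K delta (X t om)))
    (integrableX : forall t, 0 < t <= T ->
      (\int[P]_om (qnorm (- r) (expA t (inclq K delta (xi om))) ^+ 2) +
       \int[lebesgue_measure]_(s in `]0%R, t[) \int[P]_om
         HSnorm2 (- r)
           (fun u => expA (t - s)%R (B (toH (inclq K delta (X s om))) u))
       < +oo)%E)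
    (mildX : forall t, 0 < t <= T -> exists I : Omega -> isp K (- r),
      ito_integral P T F W t
        (fun s om u => expA (t - s) (B (toH (inclq K delta (X s om))) u)) I /\
      {ae P, forall om, inclq K delta (X t om) =
                        expA t (inclq K delta (xi om)) + inclq K (- r) (I om)}) :
  forall t, 0 < t <= T ->
    P [set om | range (inclq K (- 2^-1)) (inclq K delta (xi om))] = 1%E /\
    ((2 `^ (- 2^-1) * expR (- (`|eta| * t)) *
        (1 - expR (- (2 * (eta - sup (point_spectrum DA A)) * t))) `^ 2^-1)%:E
      * qnorm (- r) (expA t (inclq K (- beta) w))
      * Lnorm P 2%:E (fun om => qnorm (- 2^-1) (inclq K delta (xi om)))
     <= Lnorm P 2%:E (fun om => qnorm (- r) (inclq K delta (X t om))) < +oo)%E.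
Proof.
have onb : orthonormal_basis ip BB by case: diagA.
have cBB : countable BB.
  exact: (countable_orthonormal (e := id) hilbertH (basis_ortho onb) separableH).
(* Over an empty basis Parseval in H_(-beta) would give w = 0. The gap hypothesis of Parseval is
   then vacuous, so the constant 1 can serve as kappa. *)
have BB0 : BB !=set0.
  apply: contrapT => BBE; have noBB b : ~ BB b by move=> Bb; apply: BBE; exists b.
  have := isp_parseval hilbertH onb ltr01 (fun b Bb => False_ind _ (noBB b Bb)) w.
  rewrite esum1 => [[/esym/eqP]|b /noBB//].
  by rewrite sqrf_eq0 normr_eq0 (negbTE w_neq0).
have [kappa_gt0 gap] := spectral_gap hilbertH onb diagA specA BB0.
set kappa := eta - _ in kappa_gt0 gap *.
have w_scale := in_scale_inclq w.
have initial t : 0 < t <= T ->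
    (\int[P]_om (qnorm (- r) (expA t (inclq K delta (xi om))) ^+ 2) < +oo)%E.
  move=> tT; apply: (le_lt_trans _ (integrableX _ tT)); rewrite leeDl//.
  apply: integral_ge0 => s _; apply: integral_ge0 => om _.
  by rewrite HSnorm2E sqre_ge0.
move=> t tT; have /andP[t0 _] := tT; have t0' := ltW t0.
have upper := mild_norm_lty hilbertH onb cBB kappa_gt0 gap semigroup_expA T_gt0
  normalF brownianW w_scale measurable_xi BE initial mildX tT.
have lower := mild_norm_lower_bound hilbertH onb cBB kappa_gt0 gap semigroup_expA T_gt0
  normalF brownianW w_scale measurable_xi BE X_in_H initial mildX tT.
have := weighted_moment_lower_bound hilbertH onb cBB kappa_gt0 gap T_gt0 normalF
  measurable_xi t0.
move: lower upper; set V := weighted_moment _ _ _.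
set Q := qnorm _ (expA t _); set M := (\int[P]_om _)%E; set S := (\int[P]_om _)%E.
set c := (1 - _) / 2 => lower upper VS.
have c_gt0 : 0 < c.
  rewrite divr_gt0// subr_gt0 -expR0 ltr_expR mulNr oppr_lt0.
  by rewrite !mulr_gt0.
have [swt wt] := extended_semigroup_coef hilbertH onb kappa_gt0 gap semigroup_expA t0' w_scale.
(* Some coordinate of w is nonzero, and the semigroup multiplies it by a positive number. *)
have Q0 : (0 < Q ^+ 2)%E.
  have [b [Bb wb]] : exists b, BB b /\ isp_coef b w != 0.
    apply: contrapT => /forallNP w0; have := isp_parseval hilbertH onb kappa_gt0 gap w.
    rewrite esum1 => [[/esym/eqP]|b Bb].
      by rewrite sqrf_eq0 normr_eq0 (negbTE w_neq0).
    have /not_andP[//|/negP] := w0 b; rewrite negbK => /eqP ->.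
    by rewrite mulr0 expr0n.
  rewrite /Q (qnormE hilbertH onb kappa_gt0 gap _ swt).
  apply: (lt_le_trans _ (esum_term (j := b) _ Bb)); last by move=> ? _; rewrite lee_fin sqr_ge0.
  rewrite lte_fin lt_neqAle sqr_ge0 andbT eq_sym sqrf_eq0 wt// !mulf_eq0 !negb_or.
  rewrite (eigen_powR_neq0 kappa_gt0 gap)// gt_eqF ?expR_gt0//=.
  by rewrite (coef_inclq hilbertH onb kappa_gt0 gap).
(* If V were infinite, its product with the positive Q^2 would be infinite, against the finite upper
   bound [M]. The same argument with c passes finiteness on to [S]. *)
have V_lty : (V < +oo)%E.
  rewrite ltNge leye_eq; apply/negP => /eqP VE; move: upper.
  by rewrite ltNge (le_trans _ lower)// VE gt0_muley.
have S_lty : (S < +oo)%E.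
  rewrite ltNge leye_eq; apply/negP => /eqP SE; move: V_lty.
  by rewrite ltNge (le_trans _ VS)// SE gt0_muley.
split.
  have := initial_in_half_scale hilbertH onb cBB kappa_gt0 gap T_gt0 normalF measurable_xi.
  exact.
rewrite !Lnorm2E; last 2 first.
- by move=> om; exact: qnorm_ge0.
- by move=> om; exact: qnorm_ge0.
rewrite -/M -/S; apply/andP; split; last exact: poweR_lty.
have Q_ge0 : (0 <= Q)%E by exact: qnorm_ge0.
have S0 : (0 <= S)%E by apply: integral_ge0 => om _; exact: sqre_ge0.
have M0 : (0 <= M)%E by apply: integral_ge0 => om _; exact: sqre_ge0.
set c1 := (_ * _ * _).
have c1_ge0 : 0 <= c1 by rewrite /c1 !mulr_ge0 ?powR_ge0 ?expR_ge0.
(* The square of [c1] is c e^(-2 |eta| t), and the exponential factor is at most 1. *)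
have c1c : c1 ^+ 2 <= c.
  have sqr_powR_half (a : R) : 0 <= a -> (a `^ 2^-1) ^+ 2 = a.
    by move=> a0; rewrite powR12_sqrt// sqr_sqrtr.
  have c2 : 1 - expR (- (2 * kappa * t)) = c * 2.
    by rewrite /c mulNr mulfVK.
  have c2_ge0 : 0 <= c * 2 by rewrite pmulr_lge0 ?ltr0n// ltW.
  rewrite /c1 c2 powRN !exprMn exprVn !sqr_powR_half//.
  set E := expR _; have -> : 2^-1 * E ^+ 2 * (c * 2) = c * E ^+ 2 by field.
  rewrite ler_piMr ?(ltW c_gt0)// /E exprn_ile1 ?expR_ge0// -expR0 ler_expR oppr_le0.
  by rewrite mulr_ge0.
(* Finiteness of [Q] has not been established, so the passage between squares and roots takes place
   in the extended reals. *)
have -> : (c1%:E * Q = ((c1%:E * Q) ^+ 2) `^ 2^-1)%E.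
  by rewrite poweR12_sqrt ?sqre_ge0// sqrte_sqr gee0_abs// mule_ge0.
rewrite -poweRM ?sqre_ge0//; apply: gt0_ler_poweR.
- by rewrite invr_ge0.
- by rewrite in_itv/= leey andbT mule_ge0 ?sqre_ge0.
- by rewrite in_itv/= leey andbT.
apply: (le_trans _ lower).
have -> : ((c1%:E * Q) ^+ 2 = Q ^+ 2 * (c1 ^+ 2)%:E)%E.
  by rewrite !expe2 muleACA -EFinM muleC -expr2.
rewrite -muleA lee_wpmul2l ?sqre_ge0//; apply: (le_trans _ VS).
by rewrite lee_wpmul2r// lee_fin.
Qed.
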